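(* Let $G$ be an undirected graph on $[d]$ with $g:=|G|\ge 2$ edges. For $\delta\in[-1,1]_*^G$ let $B_\delta:=\{\varepsilon : (\delta,\varepsilon)\in\mathcal{N}^G\}$. There exists a set $\mathcal{D}\subset[-1,1]_*^G$ such that, with $\mathcal{D}^c:=[-1,1]_*^G\setminus\mathcal{D}$: (a) $\mathcal{D}^c$ is an $\mathcal{L}^g$-null set; (b) $\mathbb{S}^G_\infty\cap\mathcal{D}^c$ is an $\mathcal{H}^{g-1}$-null set; and (c) for every $\delta\in\mathcal{D}$, $B_\delta$ is finite. In particular, (d) the set $\mathcal{N}^G$ is an $\mathcal{L}^{g+1}$-null set, and $\mathcal{N}^G_\infty$ is an $\mathcal{H}^g$-null set, i.e. $\mu_G(\mathcal{N}^G_\infty)=0$.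
   Context: $[d]=\{1,\dots,d\}$. Graphs are undirected without self-loops; $|G|$ is the number of edges. $G$ is identified with its edge set, $\mathbb{R}^G$ is the space of vectors $\delta=(\delta_{ij})_{ij\in G}$ indexed by edges ($\delta_{ij}=\delta_{ji}$), identified with $\mathbb{R}^g$. $\mathcal{L}^n$ is Lebesgue measure on $\mathbb{R}^n$ and $\mathcal{H}^s$ is $s$-dimensional Hausdorff measure (on the ambient Euclidean space). Set $[-1,1]_*:=[-1,1]\setminus\{0\}$, and let $[-1,1]_*^G\subset\mathbb{R}^G$ be the set of vectors with all entries in $[-1,1]_*$. Let $\mathbb{S}^G_\infty:=\{\delta\in\mathbb{R}^G:\|\delta\|_\infty=1\}$, where $\|\cdot\|_\infty$ is the max norm. For $\delta\in\mathbb{R}^G$ and $\varepsilon>0$, let $A^{G,\delta,\varepsilon}\in\mathbb{R}^{d\times d}$ be the symmetric matrix with entries $1$ on the diagonal, $\delta_{ij}\varepsilon$ at positions $(i,j)$ with $ij\in G$, and $0$ elsewhere. Let $\varepsilon_G(\delta):=\sup\{\varepsilon>0: A^{G,\delta,\varepsilon}\text{ is positive definite}\}$. Define $$\mathcal{M}^G:=\{(\delta,\varepsilon):\delta\in[-1,1]_*^G,\ \varepsilon\in(0,\varepsilon_G(\delta))\}\subset\mathbb{R}^G\times\mathbb{R}\simeq\mathbb{R}^{g+1},\qquad \mathcal{M}^G_\infty:=\mathcal{M}^G\cap(\mathbb{S}^G_\infty\times\mathbb{R}),$$ $$\mathcal{N}^G:=\{(\delta,\varepsilon)\in\mathcal{M}^G:(A^{G,\delta,\varepsilon})^{-1}\text{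 is not perfect with respect to }G\},\qquad \mathcal{N}^G_\infty:=\mathcal{N}^G\cap(\mathbb{S}^G_\infty\times\mathbb{R}).$$ $\mu_G$ is the normalized restriction of $\mathcal{H}^g$ to $\mathcal{M}^G_\infty$, i.e. the probability measure $\mathcal{H}^g(\cdot\cap\mathcal{M}^G_\infty)/\mathcal{H}^g(\mathcal{M}^G_\infty)$ (the normalizing constant is finite and positive). A positive definite $\Sigma\in\mathbb{R}^{d\times d}$ is perfect with respect to $G$ if, for $X\sim N(0,\Sigma)$ and all disjoint $A,B,C\subset[d]$ with $A,B$ nonempty ($C$ may be empty): $C$ separates $A$ from $B$ in $G$ (every path in $G$ from a vertex of $A$ to a vertex of $B$ contains a vertex of $C$) if and only if $X_A$ and $X_B$ are conditionally independent given $X_C$, where $X_S=\{X_i:i\in S\}$. *)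

(* Defs.v *)
From HB Require Import structures.
From mathcomp Require Import all_boot all_order all_algebra.
From mathcomp Require Import all_classical all_reals all_analysis.

Set Implicit Arguments.
Unset Strict Implicit.
Unset Printing Implicit Defensive.

Import Order.TTheory GRing.Theory Num.Theory.
Import numFieldNormedType.Exports.

Local Open Scope classical_set_scope.
Local Open Scope ring_scope.

(* Throughout, R^n is the type n.-tuple R with the product (Borel)
   sigma-algebra of the library. *)

Section LebesgueHausdorff.
Variable R : realType.

Definition tuple_cons n (x : R * n.-tuple R) : n.+1.-tuple R :=
  [tuple of x.1 :: x.2].

Lemma measurable_tuple_cons n : measurable_fun [set: R * n.-tuple R] (@tuple_cons n).
Proof. exact: measurable_cons. Qed.

HB.instance Definition _ n := @isMeasurableFun.Build _ _
  (R * n.-tuple R)%type (n.+1.-tuple R) (@tuple_cons n) (@measurable_tuple_cons n).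

Section step.
Variables (n : nat) (m : {sigma_finite_measure set (n.-tuple R) -> \bar R}).

Definition lebesgue_cons : set (n.+1.-tuple R) -> \bar R :=
  pushforward (@lebesgue_measure R \x m)%E (@tuple_cons n).

Let lebesgue_cons0 : lebesgue_cons set0 = 0%E.
Proof. by rewrite /lebesgue_cons /pushforward preimage_set0 measure0. Qed.

Let lebesgue_cons_ge0 A : (0 <= lebesgue_cons A)%E.
Proof. exact: (measure_ge0 (@lebesgue_measure R \x m)%E). Qed.

Let lebesgue_cons_sigma_additive : semi_sigma_additive lebesgue_cons.
Proof.
move=> F mF tF mUF; rewrite /lebesgue_cons /pushforward preimage_bigcup.
have mc := @measurable_tuple_cons n.
apply: (@measure_semi_sigma_additive _ _ _ (@lebesgue_measure R \x m)%E).
- by move=> i; rewrite -[X in measurable X]setTI; exact: mc.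
- apply/trivIsetP => /= i j _ _ ij; rewrite -preimage_setI.
  by move/trivIsetP : tF => /(_ _ _ _ _ ij) ->//; rewrite preimage_set0.
- by rewrite -preimage_bigcup -[X in measurable X]setTI; exact: mc.
Qed.

HB.instance Definition _ := isMeasure.Build _ _ _ lebesgue_cons
  lebesgue_cons0 lebesgue_cons_ge0 lebesgue_cons_sigma_additive.

Let lebesgue_cons_sigma_finite : sigma_finite setT lebesgue_cons.
Proof.
have /sigma_finiteP[F [FT Fnd Foo]] := sigma_finiteT (@lebesgue_measure R).
have /sigma_finiteP[H [HT Hnd Hoo]] := sigma_finiteT m.
pose uncons (t : n.+1.-tuple R) := (thead t, [tuple of behead t]).
have consK : cancel (@tuple_cons n) uncons.
  by move=> [x y]; rewrite /uncons theadE; congr pair; exact: val_inj.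
have muncons : measurable_fun [set: n.+1.-tuple R] uncons.
  by apply: measurable_fun_pair; [exact: measurable_tnth|
    exact: measurable_behead].
exists (fun i => uncons @^-1` (F i `*` H i)).
  apply/esym/seteqP; split=> // t _.
  have [i _ Fi] : (\bigcup_i F i) (uncons t).1 by rewrite -FT.
  have [j _ Hj] : (\bigcup_j H j) (uncons t).2 by rewrite -HT.
  exists (maxn i j) => //; split.
    by move: Fi; exact/subsetPset/Fnd/leq_maxl.
  by move: Hj; exact/subsetPset/Hnd/leq_maxr.
move=> i; have [mF ltF] := Foo i; have [mH ltH] := Hoo i; split.
  rewrite -[X in measurable X]setTI; apply: muncons => //.
  exact: measurableX.
rewrite /lebesgue_cons /pushforward.
rewrite (_ : @tuple_cons n @^-1` _ = F i `*` H i).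
  by rewrite product_measure1E// lte_mul_pinfty// ge0_fin_numE.
by apply/seteqP; split=> z; rewrite /preimage /mkset (consK z).
Qed.

HB.instance Definition _ :=
  Measure_isSigmaFinite.Build _ _ _ lebesgue_cons lebesgue_cons_sigma_finite.
End step.

(* L^0 is the unit mass at the only point of R^0, and
   L^(n+1) is the image of L^1 \x L^n under R * R^n ~ R^(n+1). *)
Fixpoint lebesgue_tuple n : {sigma_finite_measure set (n.-tuple R) -> \bar R} :=
  match n with
  | 0 => dirac [tuple]
  | m.+1 => lebesgue_cons (lebesgue_tuple m)
  end.

Definition edist n (x y : n.-tuple R) : R :=
  Num.sqrt (\sum_(i < n) (tnth x i - tnth y i) ^+ 2).

(* The diameter of U to the power s; the empty set has weight 0, also for
   s = 0. *)
Definition diam_pow n (s : nat) (U : set (n.-tuple R)) : \bar R :=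
  ereal_sup (0%E |` [set (edist xy.1 xy.2 ^+ s)%:E | xy in U `*` U]).

Definition hausdorff_premeasure n (s : nat) (r : R) (A : set (n.-tuple R)) :
    \bar R :=
  ereal_inf [set (\sum_(0 <= k <oo) diam_pow s (U k))%E | U in
    [set U : (set (n.-tuple R))^nat |
      (forall k x y, U k x -> U k y -> edist x y <= r) /\
      A `<=` \bigcup_k U k]].

(* The s-dimensional Hausdorff (outer) measure for the Euclidean distance,
   i.e. the limit of the premeasures as r tends to 0, which is a supremum by
   monotonicity. No normalizing factor depending on s is included: such a
   factor changes neither null sets nor the probability muG below. *)
Definition hausdorff n (s : nat) (A : set (n.-tuple R)) : \bar R :=
  ereal_sup [set hausdorff_premeasure s r A | r in [set r : R | 0 < r]].

End LebesgueHausdorff.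

Arguments lebesgue_tuple R n : clear implicits.

Section Gaussian.
Variable R : realType.

Definition posdefmx d (S : 'M[R]_d) : Prop :=
  S^T = S /\ forall x : 'cV[R]_d, x != 0 -> 0 < (x^T *m S *m x) 0 0.

Definition gaussian_pdf d (S : 'M[R]_d) (x : d.-tuple R) : R :=
  let v := \col_(i < d) tnth x i in
  (Num.sqrt ((2 * pi) ^+ d * \det S))^-1 *
  expR (- (2^-1 * (v^T *m invmx S *m v) 0 0)).

(* X ~ N(0, S), for positive definite S. *)
Definition is_gaussian dO (Omega : measurableType dO) (P : probability Omega R)
    d (X : {RV P >-> d.-tuple R}) (S : 'M[R]_d) : Prop :=
  forall U, measurable U ->
    distribution P X U =
    (\int[lebesgue_tuple R d]_(x in U) (gaussian_pdf S x)%:E)%E.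

(* The subvector (X_i) for i in S, listed in increasing order of i. *)
Definition subvec dO (Omega : measurableType dO) d (X : Omega -> d.-tuple R)
    (S : {set 'I_d}) (w : Omega) : #|S|.-tuple R :=
  [tuple tnth (X w) (enum_val k) | k < #|S|].

(* f is a version of the conditional probability P(E | sigma(Z)). *)
Definition is_cond_prob dO (Omega : measurableType dO)
    (P : probability Omega R) dT (T : measurableType dT) (Z : Omega -> T)
    (E : set Omega) (f : Omega -> R) : Prop :=
  [/\ measurable_fun [set: g_sigma_algebra_preimageType Z] f,
      P.-integrable [set: Omega] (EFin \o f) &
      forall W : set Omega, g_sigma_algebra_preimage Z W ->
        (\int[P]_(w in W) (f w)%:E)%E = P (E `&` W)].

(* X_A and X_B are conditionally independent given X_C:
   P(X_A \in U, X_B \in V | X_C) = P(X_A \in U | X_C) P(X_B \in V | X_C) almost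
   surely. As versions of a conditional probability are unique up to
   null sets, this says that the product of two versions of the factors is a
   version of the left-hand side. *)
Definition cond_indep dO (Omega : measurableType dO) (P : probability Omega R)
    d (X : Omega -> d.-tuple R) (A B C : {set 'I_d}) : Prop :=
  forall (U : set (#|A|.-tuple R)) (V : set (#|B|.-tuple R)),
    measurable U -> measurable V ->
    exists f g : Omega -> R,
      [/\ is_cond_prob P (subvec X C) (subvec X A @^-1` U) f,
          is_cond_prob P (subvec X C) (subvec X B @^-1` V) g &
          is_cond_prob P (subvec X C)
            (subvec X A @^-1` U `&` subvec X B @^-1` V) (f \* g)].

End Gaussian.

(* A graph on 'I_d is its set of edges, an edge being a pair of vertices. *)
Definition simple_graph d (G : {set {set 'I_d}}) : Prop :=
  forall e, e \in G -> #|e| = 2.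

Definition adj d (G : {set {set 'I_d}}) : rel 'I_d :=
  [rel i j | [set i; j]%SET \in G].

(* x :: p is a path from x to last x p. *)
Definition separates d (G : {set {set 'I_d}}) (A B C : {set 'I_d}) : Prop :=
  forall (x : 'I_d) (p : seq 'I_d),
    path (adj G) x p -> uniq (x :: p) -> x \in A -> last x p \in B ->
    exists2 z, z \in x :: p & z \in C.

Section Perfect.
Variable R : realType.

Definition perfect d (S : 'M[R]_d) (G : {set {set 'I_d}}) : Prop :=
  forall dO (Omega : measurableType dO) (P : probability Omega R)
    (X : {RV P >-> d.-tuple R}),
    is_gaussian X S ->
    forall A B C : {set 'I_d},
      [disjoint A & B]%B -> [disjoint A & C]%B -> [disjoint B & C]%B ->
      A != finset.set0 -> B != finset.set0 ->
      separates G A B C <-> cond_indep P X A B C.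

End Perfect.

Section Model.
Variables (R : realType) (d : nat) (G : {set {set 'I_d}}).

(* R^G is identified with R^g, g = #|G|, by listing the edges of G with
   enum_val. The set cube_star is [-1,1]_*^G. *)

Definition cube_star : set (#|G|.-tuple R) :=
  [set dl | forall k, -1 <= tnth dl k <= 1 /\ tnth dl k != 0].

Definition sphere_inf : set (#|G|.-tuple R) :=
  [set dl | \big[Num.max/0]_(k < #|G|) `|tnth dl k| = 1].

Definition Amx (dl : #|G|.-tuple R) (eps : R) : 'M[R]_d :=
  \matrix_(i, j)
    if i == j then 1 else
    if [pick k : 'I_#|G| | enum_val k == [set i; j]%SET] is Some k
    then tnth dl k * eps else 0.

Definition eps_max (dl : #|G|.-tuple R) : \bar R :=
  ereal_sup [set eps%:E | eps in [set eps | 0 < eps /\ posdefmx (Amx dl eps)]].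

Definition MG : set (#|G|.-tuple R * R) :=
  [set x | [/\ cube_star x.1, 0 < x.2 & (x.2%:E < eps_max x.1)%E]].

Definition MG_inf : set (#|G|.-tuple R * R) := MG `&` (sphere_inf `*` setT).

Definition NG : set (#|G|.-tuple R * R) :=
  [set x | MG x /\ ~ perfect (invmx (Amx x.1 x.2)) G].

Definition NG_inf : set (#|G|.-tuple R * R) := NG `&` (sphere_inf `*` setT).

Definition BG (dl : #|G|.-tuple R) : set R := [set eps | NG (dl, eps)].

(* The isometry R^G x R -> R^(g+1), with eps as the first coordinate. *)
Definition flat (x : #|G|.-tuple R * R) : #|G|.+1.-tuple R :=
  tuple_cons (x.2, x.1).

Definition muG (A : set (#|G|.-tuple R * R)) : \bar R :=
  (hausdorff #|G| (flat @` (A `&` MG_inf)) / hausdorff #|G| (flat @` MG_inf))%E.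

End Model.

Arguments cube_star R {d} G.
Arguments sphere_inf R {d} G.
Arguments MG R {d} G.
Arguments MG_inf R {d} G.
Arguments NG R {d} G.
Arguments NG_inf R {d} G.

(* Main.v *)
Require Import Defs.
From mathcomp Require Import all_boot all_order all_algebra.
From mathcomp Require Import all_classical all_reals all_analysis.
From mathcomp Require Import measurable_realfun ring lra.

Set Implicit Arguments.
Unset Strict Implicit.
Unset Printing Implicit Defensive.

Import Order.TTheory GRing.Theory Num.Theory.
Import numFieldNormedType.Exports.

Local Open Scope classical_set_scope.
Local Open Scope ring_scope.

(** Write K = Amx delta eps for the precision matrix of the Gaussian vector X. If
    the coordinates outside C, a and b are integrated out of its density, K is
    replaced by a Schur complement, and X_a, X_b are conditionally independent
    given X_C exactly when the entry (a, b) of this complement is zero. With the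
    denominators cleared ([pivots]) the entry is a polynomial in the numbers
    eps * delta_ij.

    Let [faithful_poly] be the product of these polynomials over all (C, a, b)
    such that a path joins a to b outside C. If it does not vanish at
    eps * delta, then K^-1 is perfect ([perfect_criterion], [NG_zero]).
    - If C separates A from B, the entries of K split the density into a function
      of the coordinates on the side of A and one of those on the side of B, both
      depending on X_C; hence conditional independence ([cond_mul]).
    - If a path joins a in A to b in B outside C, the marginal weight of
      (x_a, x_b) with X_C fixed is w(s) u(t) exp(theta s t) with theta != 0. It
      makes the half-lines x_a >= 0 and x_b >= 0 dependent whatever the value of
      X_C ([quadrants_dependent], [gauss_halfspaces_dependent]).
    Marginals and conditional probabilities are written with iterated integrals
    over single coordinates of functions of all coordinates ([coord_ints]).

    The polynomial is not zero: if all edge weights are the same small negative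
    number, K is positive definite with nonpositive off-diagonal entries, nothing
    cancels during the elimination, and a path from a to b leaves a negative
    entry ([pivots_neg], [faithful_poly_neq0]).

    So N^G lies in the zero set of faithful_poly (eps * delta). Let D consist of
    the delta for which this is not identically zero in eps; then B_delta is
    contained in the set of roots of a nonzero polynomial, hence finite. The
    complement of D is contained in the zero set of faithful_poly itself, and
    zero sets of nonzero polynomials are Lebesgue null ([polyfun_zeros_null]),
    which also applies to N^G in dimension g + 1.

    The sphere of the max norm is a union of faces delta_k = 1 or delta_k = -1 of
    the cube. Both on such a face and on its product with the line of eps, the
    relevant polynomial is still not zero ([face_scale]), and it has one variable
    less than the ambient space. Within bounded sets its null zero set, being
    closed, is covered by finitely many small cubes of small total volume, so the
    Hausdorff measure in that dimension vanishes ([face_zeros_null]). Boundedness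
    on the product holds because eps < 1 when some delta_k is 1 or -1
    ([MG_eps_lt1]). *)

(** * Division-free Gaussian elimination *)

Section Pivot.
Variables (R : realType) (d : nat).
Implicit Types (M : 'M[R]_d) (x : d.-tuple R) (i j k : 'I_d) (T : {set 'I_d}).

Definition qf M x : R := \sum_i \sum_j M i j * tnth x i * tnth x j.

Definition upd_coord n (x : n.-tuple R) (i : 'I_n) (t : R) : n.-tuple R :=
  [tuple if j == i then t else tnth x j | j < n].

(** The Schur complement of M in the coordinate i, multiplied by M i i: without
    the division its entries are polynomials in those of M. Row and column i
    become zero, which lets the matrix keep its size. *)
Definition pivot i M : 'M[R]_d :=
  \matrix_(j, k) (M i i * M j k - M j i * M i k).

Definition pivots (s : seq 'I_d) M : 'M[R]_d := foldr pivot M s.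

Definition symmx M := forall i j, M i j = M j i.

Definition pd_on T M := forall x, (forall i, i \notin T -> tnth x i = 0) ->
  (exists i, tnth x i != 0) -> 0 < qf M x.

Lemma pivot_symm i M : symmx M -> symmx (pivot i M).
Proof. by move=> sM j k; rewrite !mxE (sM j k) (sM j i) (sM i k); ring. Qed.

Lemma pivots_symm s M : symmx M -> symmx (pivots s M).
Proof. by move=> sM; elim: s => //= i s IH; exact: pivot_symm. Qed.

Lemma pivot_rowE i M k : pivot i M i k = 0.
Proof. by rewrite mxE subrr. Qed.

Lemma pivot_colE i M j : pivot i M j i = 0.
Proof. by rewrite mxE mulrC subrr. Qed.

Lemma tnth_upd n (x : n.-tuple R) (i : 'I_n) t (j : 'I_n) :
  tnth (upd_coord x i t) j = if j == i then t else tnth x j.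
Proof. by rewrite tnth_mktuple. Qed.

Lemma updE n (x : n.-tuple R) (i : 'I_n) t : tnth (upd_coord x i t) i = t.
Proof. by rewrite tnth_upd eqxx. Qed.

Lemma qf_upd_coord_pivot i M x t : qf (pivot i M) (upd_coord x i t) = qf (pivot i M) x.
Proof.
rewrite /qf; apply: eq_bigr => j _; apply: eq_bigr => k _; rewrite !tnth_upd.
case: (eqVneq j i) => [->|_]; first by rewrite pivot_rowE !mul0r.
by case: (eqVneq k i) => [->|//]; rewrite pivot_colE !mul0r.
Qed.

(** Completing the square in the coordinate i. *)
Lemma qf_pivot i M x : symmx M ->
  M i i * qf M x = (\sum_j M i j * tnth x j) ^+ 2 + qf (pivot i M) x.
Proof.
move=> sM; rewrite /qf expr2 mulr_suml mulr_sumr -big_split/=.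
apply: eq_bigr => j _; rewrite !mulr_sumr -big_split/=.
by apply: eq_bigr => k _; rewrite !mxE (sM j i); ring.
Qed.

(** As a function of t this is a multiple of a square plus a constant: its
    minimum gives [pd_on_pivot], and its Gaussian integral [coord_int_gauss]. *)
Lemma qf_updE i M x t : symmx M -> M i i != 0 ->
  qf M (upd_coord x i t) =
  M i i * (t + (M i i)^-1 * \sum_(j | j != i) M i j * tnth x j) ^+ 2
  + (M i i)^-1 * qf (pivot i M) x.
Proof.
move=> sM M0; apply: (mulfI M0); rewrite qf_pivot// qf_upd_coord_pivot mulrDr mulVKf//.
congr (_ + _); rewrite (bigD1 i)//= updE.
rewrite (eq_bigr (fun j => M i j * tnth x j)); last first.
  by move=> j /negPf ji; rewrite tnth_upd ji.
by field.
Qed.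

Lemma qf_diag i M : qf M (upd_coord [tuple 0 | j < d] i 1) = M i i.
Proof.
rewrite /qf (bigD1 i)//= [X in _ + X]big1 ?addr0; last first.
  move=> j /negPf ji; rewrite big1// => k _.
  by rewrite tnth_upd ji tnth_mktuple mulr0 mul0r.
rewrite (bigD1 i)//= [X in _ + X]big1 ?addr0 ?updE ?mulr1//.
by move=> j /negPf ji; rewrite !tnth_upd ji tnth_mktuple mulr0.
Qed.

Lemma pd_on_diag T M i : pd_on T M -> i \in T -> 0 < M i i.
Proof.
move=> pM iT; rewrite -qf_diag; apply: pM; last first.
  by exists i; rewrite updE oner_neq0.
move=> j jT; rewrite tnth_upd tnth_mktuple; case: eqP => // ji.
by move: jT; rewrite ji iT.
Qed.

(** Up to the factor M i i, the value at x of the form of the pivoted matrix is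
    the minimum of the form of M over the coordinate i. *)
Lemma pd_on_pivot T M i : symmx M -> pd_on T M -> i \in T ->
  pd_on (T :\ i)%SET (pivot i M).
Proof.
move=> sM pM iT x x0 [j xj]; have Mi := pd_on_diag pM iT.
pose l := \sum_(j | j != i) M i j * tnth x j.
have := qf_updE x (- ((M i i)^-1 * l)) sM (lt0r_neq0 Mi).
rewrite addNr expr0n mulr0 add0r => qE.
rewrite -(pmulr_rgt0 _ (_ : 0 < (M i i)^-1)) ?invr_gt0// -qE; apply: pM.
  move=> k kT; rewrite tnth_upd; case: eqP => [ki|_]; first by rewrite ki iT in kT.
  by apply: x0; rewrite !inE negb_and kT orbT.
exists j; rewrite tnth_upd; case: (eqVneq j i) => // ji.
by move: xj; rewrite ji x0 ?eqxx// !inE eqxx.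
Qed.

Lemma pd_on_pivots (s : seq 'I_d) T M : symmx M -> pd_on T M -> uniq s ->
  {subset s <= T} -> pd_on (T :\: [set i in s])%SET (pivots s M).
Proof.
move=> sM pM; elim: s => [_ _|i s IH /= /andP[si us] sT] /=.
  by move=> x x0; apply: pM => i iT; apply: x0; rewrite !inE.
have -> : (T :\: [set j in i :: s] = (T :\: [set j in s]) :\ i)%SET.
  by apply/setP => j; rewrite !inE negb_or andbA.
apply: pd_on_pivot; first exact: pivots_symm.
  by apply: IH => // j js; apply: sT; rewrite inE js orbT.
by rewrite !inE si sT// inE eqxx.
Qed.

Definition offdiag_npos M := forall i j, i != j -> M i j <= 0.

Definition neg_rel T M : rel 'I_d :=
  [rel i j | [&& i \in T, j \in T, i != j & M i j < 0]].

Lemma offdiag_npos_pivot i M : offdiag_npos M -> 0 < M i i ->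
  offdiag_npos (pivot i M).
Proof.
move=> nM Mi j k jk.
case: (eqVneq j i) => [->|ji]; first by rewrite pivot_rowE.
case: (eqVneq k i) => [->|ki]; first by rewrite pivot_colE.
rewrite mxE subr_le0 (le_trans (_ : _ <= 0))//.
  by rewrite pmulr_rle0// nM.
by rewrite mulr_le0// nM// eq_sym.
Qed.

(** The two terms of a pivoted off-diagonal entry are both nonpositive, so they
    cannot cancel: the edges between the remaining vertices stay, and the
    neighbours of the eliminated vertex become adjacent. *)
Lemma neg_rel_pivot_connect i M T a b : symmx M -> offdiag_npos M -> 0 < M i i ->
  a != i -> b != i -> connect (neg_rel T M) a b ->
  connect (neg_rel (T :\ i)%SET (pivot i M)) a b.
Proof.
move=> sM nM Mi ai bi /connectP[p pp bE].
set e' := neg_rel _ (pivot i M).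
have e'old v w : v != i -> w != i -> neg_rel T M v w -> e' v w.
  move=> vi wi /and4P[vT wT vw Mvw]; rewrite /e' /neg_rel/= !inE vi wi vT wT vw /= mxE.
  rewrite subr_lt0 (lt_le_trans (_ : _ < 0))//; first by rewrite pmulr_rlt0.
  by rewrite mulr_le0// nM// eq_sym.
have e'new v w : v != i -> w != i -> v != w ->
    neg_rel T M v i -> neg_rel T M i w -> e' v w.
  move=> vi wi vw /and4P[vT _ _ Mvi] /and4P[_ wT _ Miw].
  rewrite /e' /neg_rel/= !inE vi wi vT wT vw /= mxE subr_lt0.
  rewrite (le_lt_trans (_ : _ <= 0))//; first by rewrite pmulr_rle0// nM.
  by rewrite nmulr_rgt0.
(* A walk that has just entered i is recorded by its last vertex j before i. *)
suff [+ _] : (last a p != i -> connect e' a (last a p)) /\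
    (last a p = i -> exists2 j, j != i & connect e' a j /\ neg_rel T M j i).
  by rewrite -bE; apply.
elim/last_ind: p pp {bE bi} => [_|p w IH] /=.
  by split=> // aE; rewrite aE eqxx in ai.
rewrite rcons_path last_rcons => /andP[pp ew]; have [IH1 IH2] := IH pp.
case: (eqVneq (last a p) i) => li.
  have [j ji [aj eji]] := IH2 li; split=> [wi|wi].
    case: (eqVneq j w) => [<-//|jw]; apply: connect_trans aj (connect1 _).
    by apply: e'new => //; rewrite -li.
  by move: ew; rewrite li wi /neg_rel/= eqxx !andbF.
split=> [wi|wi].
  by apply: connect_trans (IH1 li) (connect1 _); exact: e'old.
by exists (last a p) => //; split; [exact: IH1|rewrite -wi].
Qed.

(** When only a and b are left, being connected has become being adjacent. *)
Lemma pivots_neg s T M a b : symmx M -> offdiag_npos M -> pd_on T M -> uniq s ->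
  {subset s <= T} -> a \notin s -> b \notin s -> a != b ->
  (forall i, i \in T -> i \notin s -> i = a \/ i = b) ->
  connect (neg_rel T M) a b -> pivots s M a b < 0.
Proof.
move=> sM nM pM us sT as_ bs ab Tab cab.
suff [_ /connectP[[|w p]/= pp bE]] : offdiag_npos (pivots s M) /\
    connect (neg_rel (T :\: [set i in s])%SET (pivots s M)) a b.
- by rewrite bE eqxx in ab.
- move: pp => /andP[/and4P[_ wT aw Maw] _].
  move: wT; rewrite !inE => /andP[ws wT].
  have [wa|wb] := Tab _ wT ws; first by rewrite wa eqxx in aw.
  by rewrite -wb.
elim: s us sT as_ bs {Tab} => [|i s IH] /= => [_ _ _ _|/andP[si us] sT].
  by split=> //; move: cab; rewrite (_ : T :\: _ = T)%SET//; apply/setP => j; rewrite !inE.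
rewrite !inE !negb_or => /andP[ai as_] /andP[bi bs].
have sT' : {subset s <= T} by move=> j js; apply: sT; rewrite inE js orbT.
have [n' c'] := IH us sT' as_ bs.
have Mi : 0 < pivots s M i i.
  apply: (pd_on_diag (pd_on_pivots sM pM us sT')).
  by rewrite !inE si sT// inE eqxx.
have -> : (T :\: [set j in i :: s] = (T :\: [set j in s]) :\ i)%SET.
  by apply/setP => j; rewrite !inE negb_or andbA.
by split; [exact: offdiag_npos_pivot|apply: neg_rel_pivot_connect => //; exact: pivots_symm].
Qed.

End Pivot.

(** * Polynomial functions on tuples *)

Section Polyfun.
Variable R : realType.

(** A predicate on functions rather than a type of formal polynomials: only
    values matter below, and substitution is immediate. *)
Inductive polyfun n : (n.-tuple R -> R) -> Prop :=
| polyfun_cst c : polyfun (fun=> c)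
| polyfun_coord i : polyfun (fun x => tnth x i)
| polyfunD f g : polyfun f -> polyfun g -> polyfun (fun x => f x + g x)
| polyfunM f g : polyfun f -> polyfun g -> polyfun (fun x => f x * g x).

Lemma polyfun_comp n m f (u : m.-tuple R -> n.-tuple R) :
  polyfun f -> (forall i, polyfun (fun x => tnth (u x) i)) ->
  polyfun (fun x => f (u x)).
Proof.
move=> pf pu; elim: pf => [c|i|f1 g1 _ IH1 _ IH2|f1 g1 _ IH1 _ IH2] //.
- exact: polyfun_cst.
- exact: polyfunD.
- exact: polyfunM.
Qed.

Lemma polyfun_prod n (I : Type) (r : seq I) (P : pred I) (F : I -> n.-tuple R -> R) :
  (forall i, P i -> polyfun (F i)) -> polyfun (fun x => \prod_(i <- r | P i) F i x).
Proof.
move=> pF; elim: r => [|i r IH].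
  by under eq_fun do rewrite big_nil; exact: polyfun_cst.
under eq_fun do rewrite big_cons.
by case: (boolP (P i)) => [/pF Pi|//]; exact: polyfunM.
Qed.

Lemma polyfun_pivots d n (M : n.-tuple R -> 'M[R]_d) s :
  (forall i j, polyfun (fun y => M y i j)) ->
  forall i j, polyfun (fun y => pivots s (M y) i j).
Proof.
move=> pM; elim: s => [//|k s IH] i j /=.
under eq_fun do rewrite /pivot mxE -mulN1r.
apply: polyfunD; first exact: polyfunM.
by apply: polyfunM; [exact: polyfun_cst|exact: polyfunM].
Qed.

Lemma polyfun_line n (f : n.-tuple R -> R) (u : R -> n.-tuple R) :
  polyfun f -> (forall i, exists p : {poly R}, forall t, tnth (u t) i = p.[t]) ->
  exists p : {poly R}, forall t, f (u t) = p.[t].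
Proof.
move=> pf pu; elim: pf => [c|//|f1 g1 _ [p pE] _ [q qE]|f1 g1 _ [p pE] _ [q qE]].
- by exists c%:P => t; rewrite hornerC.
- by exists (p + q) => t; rewrite hornerD pE qE.
- by exists (p * q) => t; rewrite hornerM pE qE.
Qed.

(** A univariate polynomial that is not zero has finitely many roots; they are
    listed by splitting off linear factors. *)
Lemma polyfun_line_finite n (f : n.-tuple R -> R) (u : R -> n.-tuple R) :
  polyfun f -> (forall i, exists p : {poly R}, forall t, tnth (u t) i = p.[t]) ->
  (exists t, f (u t) != 0) -> finite_set [set t | f (u t) = 0].
Proof.
move=> pf pu [t0 ft0]; have [p pE] := polyfun_line pf pu.
have p0 : p != 0 by apply: contraNneq ft0 => p0; rewrite pE p0 horner0.
rewrite (_ : [set _ | _] = [set t | p.[t] = 0]); last first.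
  by apply/seteqP; split=> t /=; rewrite pE.
have [rs rsP] : exists rs : seq R, forall t, p.[t] = 0 -> t \in rs.
  elim: {p pE}(size p) {-2}p (leqnn (size p)) p0 => [q|m IH q sq q0].
    by rewrite leqn0 size_poly_eq0 => /eqP->; rewrite eqxx.
  have [[t /eqP/factor_theorem[q' qE]]|nr] := pselect (exists t, q.[t] = 0).
    have q'0 : q' != 0 by apply: contraNneq q0 => q'0; rewrite qE q'0 mul0r.
    have [|//|rs rsP] := IH q'.
      by move: sq; rewrite qE size_Mmonic// ?monicXsubC// size_XsubC addn2.
    exists (t :: rs) => s /eqP; rewrite qE hornerM !hornerE mulf_eq0 inE => /orP[/eqP/rsP->|].
      by rewrite orbT.
    by rewrite subr_eq0 => ->.
  by exists [::] => t qt; exfalso; apply: nr; exists t.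
apply: (@sub_finite_set _ _ [set` rs]); last exact: finite_seq.
by move=> t /= /rsP.
Qed.

End Polyfun.

(** * Integration over selected coordinates *)

Section CoordinateIntegrals.
Variable R : realType.
Local Notation mu := (@lebesgue_measure R).

(** The hypotheses of Tonelli's theorem. *)
Definition mnneg n (F : n.-tuple R -> \bar R) :=
  measurable_fun setT F /\ forall x, (0 <= F x)%E.

Lemma measurable_upd2 n (i : 'I_n) :
  measurable_fun [set: n.-tuple R * R] (fun z => upd_coord z.1 i z.2).
Proof.
apply/measurable_fun_tnthP => j.
rewrite (_ : _ \o _ = fun z : n.-tuple R * R => if j == i then z.2 else tnth z.1 j); last first.
  by apply/funext => z /=; rewrite tnth_upd.
case: (j == i); first exact: measurable_snd.
exact: (measurableT_comp (@measurable_tnth _ R n j) measurable_fst).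
Qed.

Lemma measurable_upd n (x : n.-tuple R) (i : 'I_n) :
  measurable_fun [set: R] (upd_coord x i).
Proof.
apply/measurable_fun_tnthP => j.
rewrite (_ : _ \o _ = fun t => if j == i then t else tnth x j); last first.
  by apply/funext => z /=; rewrite tnth_upd.
by case: (j == i); [exact: measurable_id|exact: measurable_cst].
Qed.

Lemma mnneg_upd n (F : n.-tuple R -> \bar R) x i : mnneg F ->
  measurable_fun [set: R] (fun t => F (upd_coord x i t)).
Proof.
move=> [mF _].
by have := measurableT_comp mF (@measurable_upd n x i).
Qed.

(** The integral over the i-th coordinate, still regarded as a function of all
    coordinates: iterating it in any order avoids reindexing tuples. *)
Definition coord_int n (i : 'I_n) (F : n.-tuple R -> \bar R) (x : n.-tuple R) :
    \bar R :=
  (\int[mu]_t F (upd_coord x i t))%E.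

Definition coord_ints n (s : seq 'I_n) (F : n.-tuple R -> \bar R) := foldr (@coord_int n) F s.

Lemma mnneg_coord_int n i (F : n.-tuple R -> \bar R) : mnneg F -> mnneg (coord_int i F).
Proof.
move=> [mF F0]; split; last by move=> x; apply: integral_ge0 => t _.
apply: (@measurable_fun_fubini_tonelli_F _ _ _ _ _ mu
  (fun z : n.-tuple R * R => F (upd_coord z.1 i z.2))).
- exact: (measurableT_comp mF (@measurable_upd2 n i)).
- by move=> z.
Qed.

Lemma mnneg_coord_ints n s (F : n.-tuple R -> \bar R) : mnneg F -> mnneg (coord_ints s F).
Proof. by move=> mF; elim: s => //= i s IH; exact: mnneg_coord_int. Qed.

Lemma updC n (x : n.-tuple R) i j s t : i != j ->
  upd_coord (upd_coord x i s) j t = upd_coord (upd_coord x j t) i s.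
Proof.
move=> ij; apply: eq_from_tnth => k; rewrite !tnth_upd.
by case: (eqVneq k j) => // ->; rewrite eq_sym (negPf ij).
Qed.

Lemma upd_coord_idem n (x : n.-tuple R) i s t : upd_coord (upd_coord x i s) i t = upd_coord x i t.
Proof. by apply: eq_from_tnth => k; rewrite !tnth_upd; case: eqP. Qed.

(** Tonelli's theorem in two coordinates. *)
Lemma coord_intC n i j (F : n.-tuple R -> \bar R) : mnneg F ->
  coord_int i (coord_int j F) = coord_int j (coord_int i F).
Proof.
move=> [mF F0]; case: (eqVneq i j) => [->//|ij]; apply/funext => x.
rewrite /coord_int (@fubini_tonelli _ _ _ _ _ mu mu
  (fun z : R * R => F (upd_coord (upd_coord x i z.1) j z.2))).
- by apply: eq_integral => t _; apply: eq_integral => s _; rewrite updC.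
- apply: (measurableT_comp mF); apply/measurable_fun_tnthP => k.
  rewrite (_ : _ \o _ = fun z : R * R => if k == j then z.2 else
    if k == i then z.1 else tnth x k); last first.
    by apply/funext => z /=; rewrite !tnth_upd.
  case: (k == j); first exact: measurable_snd.
  by case: (k == i); [exact: measurable_fst|exact: measurable_cst].
- by move=> z.
Qed.

Lemma coord_ints_cat n s1 s2 (F : n.-tuple R -> \bar R) :
  coord_ints (s1 ++ s2) F = coord_ints s1 (coord_ints s2 F).
Proof. exact: foldr_cat. Qed.

Lemma coord_ints_rem n i s (F : n.-tuple R -> \bar R) : mnneg F -> i \in s ->
  coord_ints s F = coord_int i (coord_ints (rem i s) F).
Proof.
move=> mF; elim: s => [//|j s IH]; rewrite inE /=.
case: (eqVneq j i) => [->//|ji] /= /IH E.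
by rewrite E coord_intC//; exact: mnneg_coord_ints.
Qed.

Lemma coord_ints_perm n s1 s2 (F : n.-tuple R -> \bar R) : mnneg F ->
  perm_eq s1 s2 -> coord_ints s1 F = coord_ints s2 F.
Proof.
move=> mF; elim: s1 s2 => [|i s1 IH] s2 p12.
  by move: p12; rewrite perm_sym => /perm_nilP->.
have is2 : i \in s2 by rewrite -(perm_mem p12) inE eqxx.
rewrite (coord_ints_rem mF is2) /= (IH (rem i s2))//.
by rewrite -(perm_cons i) (perm_trans p12)// perm_to_rem.
Qed.

Lemma coord_ints_ge0 n s (F : n.-tuple R -> \bar R) x : mnneg F -> (0 <= coord_ints s F x)%E.
Proof. by move=> /(mnneg_coord_ints s)[]. Qed.

Lemma coord_int_le n i (F G : n.-tuple R -> \bar R) : mnneg F -> mnneg G ->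
  (forall x, F x <= G x)%E -> forall x, (coord_int i F x <= coord_int i G x)%E.
Proof.
move=> mF mG FG x; apply: ge0_le_integral => //.
- by move=> t _; exact: mF.2.
- exact: mnneg_upd.
- exact: mnneg_upd.
Qed.

Lemma coord_ints_le n s (F G : n.-tuple R -> \bar R) : mnneg F -> mnneg G ->
  (forall x, F x <= G x)%E -> forall x, (coord_ints s F x <= coord_ints s G x)%E.
Proof.
by move=> mF mG FG; elim: s => //= i s IH; apply: coord_int_le => //; exact: mnneg_coord_ints.
Qed.

Definition indep_of (T : Type) n (s : seq 'I_n) (r : n.-tuple R -> T) :=
  forall x i t, i \in s -> r (upd_coord x i t) = r x.

Lemma coord_intMl n i (r F : n.-tuple R -> \bar R) : mnneg F -> (forall x, 0 <= r x)%E ->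
  indep_of [:: i] r -> coord_int i (fun x => r x * F x)%E = (fun x => r x * coord_int i F x)%E.
Proof.
move=> mF r0 ri; apply/funext => x; rewrite /coord_int.
under eq_integral do rewrite ri ?inE//.
rewrite ge0_integralZl//.
- exact: mnneg_upd.
- by move=> t _; exact: mF.2.
Qed.

Lemma coord_intsMl n s (r F : n.-tuple R -> \bar R) : mnneg F -> mnneg r ->
  indep_of s r -> coord_ints s (fun x => r x * F x)%E = (fun x => r x * coord_ints s F x)%E.
Proof.
move=> mF mr; elim: s => //= i s IH ri.
rewrite IH; last by move=> x j t js; apply: ri; rewrite inE js orbT.
rewrite coord_intMl//; [exact: mnneg_coord_ints|exact: mr.2|].
by move=> x j t; rewrite inE => /eqP->; apply: ri; rewrite inE eqxx.
Qed.

Lemma coord_int_indep n i s (F : n.-tuple R -> \bar R) :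
  indep_of s F -> indep_of (i :: s) (coord_int i F).
Proof.
move=> sF x j t; rewrite inE => /orP[/eqP->|js].
  by apply: eq_integral => u _; rewrite upd_coord_idem.
apply: eq_integral => u _; case: (eqVneq i j) => [->|ij]; first by rewrite upd_coord_idem.
by rewrite updC 1?eq_sym// sF.
Qed.

Lemma coord_int_indep_keep n i s (F : n.-tuple R -> \bar R) :
  indep_of s F -> indep_of s (coord_int i F).
Proof. by move=> /coord_int_indep-/(_ i) H x j t js; apply: H; rewrite inE js orbT. Qed.

Lemma coord_ints_indep_keep n s s' (F : n.-tuple R -> \bar R) :
  indep_of s F -> indep_of s (coord_ints s' F).
Proof. by move=> sF; elim: s' => //= i s' IH; exact: coord_int_indep_keep. Qed.

Lemma coord_ints_indep n s (F : n.-tuple R -> \bar R) : indep_of s (coord_ints s F).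
Proof. by elim: s => [|i s IH] //=; exact: coord_int_indep. Qed.

(** The coordinates in s are changed one at a time: the tuple z k of the proof
    agrees with y below k and with x from k on. *)
Lemma indep_of_eq (T : Type) n (s : seq 'I_n) (r : n.-tuple R -> T) x y :
  indep_of s r -> (forall i, i \notin s -> tnth x i = tnth y i) -> r x = r y.
Proof.
move=> rs xy; pose z k := [tuple if (i < k)%N then tnth y i else tnth x i | i < n].
suff H k : (k <= n)%N -> r (z k) = r x.
  rewrite -(H n)//; congr r; apply: eq_from_tnth => i.
  by rewrite tnth_mktuple ltn_ord.
elim: k => [_|k IH kn].
  by congr r; apply: eq_from_tnth => i; rewrite tnth_mktuple.
rewrite -IH ?(ltnW kn)//; pose j := Ordinal kn.
case: (boolP (j \in s)) => js.
  rewrite -(rs (z k) j (tnth y j) js); congr r; apply: eq_from_tnth => i.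
  rewrite tnth_upd !tnth_mktuple -val_eqE/= ltnS.
  by case: (ltngtP i k) => //= ik; congr tnth; apply: val_inj.
congr r; apply: eq_from_tnth => i; rewrite !tnth_mktuple ltnS.
case: (ltngtP i k) => //= ik; rewrite (_ : i = j) ?xy//; exact: val_inj.
Qed.

Lemma integral_lebesgue_cons n (F : n.+1.-tuple R -> \bar R) : mnneg F ->
  (\int[lebesgue_tuple R n.+1]_x F x =
   \int[mu]_t \int[lebesgue_tuple R n]_y F (tuple_cons (t, y)))%E.
Proof.
move=> [mF F0].
transitivity (\int[pushforward (mu \x lebesgue_tuple R n)%E (@tuple_cons R n)]_x F x)%E.
  apply: eq_measure_integral; first exact: measurable_tuple_cons.
  by [].
rewrite ge0_integral_pushforward//; last exact: measurable_tuple_cons.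
rewrite preimage_setT.
rewrite (@fubini_tonelli1 _ _ _ _ _ mu (lebesgue_tuple R n) (F \o @tuple_cons R n))//.
- exact: (measurableT_comp mF (@measurable_tuple_cons R n)).
- by move=> z; exact: F0.
Qed.

Lemma upd0_cons n (t u : R) (y : n.-tuple R) :
  upd_coord (tuple_cons (t, y)) ord0 u = tuple_cons (u, y).
Proof.
apply: eq_from_tnth => i; rewrite tnth_upd /tuple_cons/=.
by case: (unliftP ord0 i) => [j|] ->; rewrite ?eq_liftF ?tnthS ?tnth0 ?eqxx.
Qed.

Lemma updS_cons n (t u : R) (y : n.-tuple R) j :
  upd_coord (tuple_cons (t, y)) (lift ord0 j) u = tuple_cons (t, upd_coord y j u).
Proof.
apply: eq_from_tnth => i; rewrite tnth_upd /tuple_cons/=.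
case: (unliftP ord0 i) => [k|] -> /=; first by rewrite !tnthS tnth_upd (inj_eq (@lift_inj _ _)).
by rewrite !tnth0.
Qed.

Lemma coord_ints_lift n s (F : n.+1.-tuple R -> \bar R) t y :
  coord_ints [seq lift ord0 i | i <- s] F (tuple_cons (t, y)) =
  coord_ints s (fun y' => F (tuple_cons (t, y'))) y.
Proof.
elim: s y => //= i s IH y; apply: eq_integral => u _.
by rewrite updS_cons; exact: IH.
Qed.

Lemma mnneg_cons n (F : n.+1.-tuple R -> \bar R) t : mnneg F ->
  mnneg (fun y => F (tuple_cons (t, y))).
Proof.
move=> [mF F0]; split=> //; apply: (measurableT_comp mF).
apply: (@measurable_cons _ _ _ _ (fun=> t) n (fun y => y)); first exact: measurable_cst.
exact: measurable_id.
Qed.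

(** All coordinates are integrated away on the right, which is why the point x
    may be arbitrary. *)
Lemma integral_coord_ints n (F : n.-tuple R -> \bar R) x : mnneg F ->
  (\int[lebesgue_tuple R n]_y F y)%E = coord_ints (enum 'I_n) F x.
Proof.
elim: n F x => [|n IH] F x mF.
  rewrite /= integral_dirac//; last exact: mF.1.
  by rewrite diracT mul1e enum_ord0/= [x]tuple0.
rewrite integral_lebesgue_cons// enum_ordSl/=.
apply: eq_integral => t _.
have -> : x = tuple_cons (thead x, [tuple of behead x]) by exact: tuple_eta.
by rewrite upd0_cons coord_ints_lift -IH//; exact: mnneg_cons.
Qed.

End CoordinateIntegrals.

(** * Marginals of Gaussian weights *)

Section Gauss.
Variable R : realType.
Local Notation mu := (@lebesgue_measure R).

(** Gaussian densities without their normalization. The parameter s makes the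
    family stable under marginals: it absorbs the pivots that [pivot] does not
    divide by. *)
Definition gauss d (c s : R) (M : 'M[R]_d) (x : d.-tuple R) : R :=
  c * expR (- (s * qf M x)).

Lemma measurable_qf d (M : 'M[R]_d) : measurable_fun setT (qf M).
Proof.
apply: measurable_sum => i; apply: measurable_sum => j.
apply: measurable_funM; last exact: measurable_tnth.
by apply: measurable_funM; [exact: measurable_cst|exact: measurable_tnth].
Qed.

Lemma measurable_gauss d c s (M : 'M[R]_d) : measurable_fun setT (gauss c s M).
Proof.
apply: measurable_funM; first exact: measurable_cst.
apply: (measurableT_comp (@measurable_expR R)).
apply: (measurableT_comp (@oppr_measurable R setT)).
by apply: measurable_funM; [exact: measurable_cst|exact: measurable_qf].
Qed.

Lemma gauss_gt0 d c s (M : 'M[R]_d) x : 0 < c -> 0 < gauss c s M x.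
Proof. by move=> c0; rewrite mulr_gt0// expR_gt0. Qed.

Lemma mnneg_gauss d c s (M : 'M[R]_d) : 0 < c -> mnneg (EFin \o gauss c s M).
Proof.
move=> c0; split; first by apply/measurable_EFinP; exact: measurable_gauss.
by move=> x; rewrite lee_fin ltW// gauss_gt0.
Qed.

(** The integrand is a multiple of the normal density of mean - u and variance
    1 / (2 a). *)
Lemma integral_gauss1 (a u k : R) : 0 < a ->
  (\int[mu]_t (k * expR (- (a * (t + u) ^+ 2)))%:E =
   (k * (normal_peak (Num.sqrt (2^-1 * a^-1)))^-1)%:E)%E.
Proof.
move=> a0; set sg := Num.sqrt _.
have sg0 : sg != 0 by rewrite lt0r_neq0// sqrtr_gt0 mulr_gt0// invr_gt0.
have pk0 := normal_peak_gt0 sg0.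
have E t : (k * expR (- (a * (t + u) ^+ 2)))%:E =
    ((k * (normal_peak sg)^-1)%:E * (normal_pdf (- u) sg t)%:E)%E.
  rewrite normal_pdfE// -EFinM /normal_fun opprK; congr EFin.
  rewrite -mulrA mulKf ?lt0r_neq0//; congr (_ * expR _).
  rewrite sqr_sqrtr; last by rewrite mulr_ge0// invr_ge0 ltW.
  rewrite -mulr_natr; field; exact: lt0r_neq0.
under eq_integral do rewrite E.
rewrite integralZl//; last exact: integrable_normal_pdf.
by rewrite integral_normal_pdf mule1.
Qed.

Lemma coord_int_gauss d c s (M : 'M[R]_d) i : symmx M -> 0 < M i i -> 0 < c -> 0 < s ->
  exists2 c', 0 < c' & coord_int i (EFin \o gauss c s M) =
    EFin \o gauss c' (s / M i i) (pivot i M).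
Proof.
move=> sM Mi c0 s0; have a0 : 0 < s * M i i by rewrite mulr_gt0.
pose pk := normal_peak (Num.sqrt (2^-1 * (s * M i i)^-1)).
have pk0 : 0 < pk.
  by apply: normal_peak_gt0; rewrite lt0r_neq0// sqrtr_gt0 mulr_gt0// invr_gt0.
exists (c * pk^-1); first by rewrite mulr_gt0// invr_gt0.
apply/funext => x; rewrite /coord_int /=.
set u := (M i i)^-1 * \sum_(j | j != i) M i j * tnth x j.
transitivity (\int[mu]_t ((c * expR (- (s / M i i * qf (pivot i M) x))) *
    expR (- ((s * M i i) * (t + u) ^+ 2)))%:E)%E.
  apply: eq_integral => t _; rewrite /gauss qf_updE ?lt0r_neq0// -/u -mulrA -expRD.
  congr ((_ * expR _)%:E); ring.
rewrite integral_gauss1//; congr EFin; rewrite /gauss -/pk; ring.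
Qed.

(** Integrating out the coordinates in l replaces the matrix by its Schur
    complement, up to a positive factor. *)
Lemma coord_ints_gauss d c s (M : 'M[R]_d) T (l : seq 'I_d) : symmx M -> pd_on T M ->
  uniq l -> {subset l <= T} -> 0 < c -> 0 < s ->
  exists c' s', [/\ 0 < c', 0 < s' & coord_ints l (EFin \o gauss c s M) =
    EFin \o gauss c' s' (pivots l M)].
Proof.
move=> sM pM + + c0 s0; elim: l => [_ _|i l IH /= /andP[il ul] lT].
  by exists c, s.
have lT' : {subset l <= T} by move=> j jl; apply: lT; rewrite inE jl orbT.
have [c1 [s1 [c10 s10 ->]]] := IH ul lT'.
have Mi : 0 < pivots l M i i.
  apply: (pd_on_diag (pd_on_pivots sM pM ul lT')).
  by rewrite !inE il lT// inE eqxx.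
have [c2 c20 ->] := coord_int_gauss (pivots_symm l sM) Mi c10 s10.
by exists c2, (s1 / pivots l M i i); split => //; rewrite divr_gt0.
Qed.

End Gauss.

(** * Conditional probabilities from a density *)

Section Density.
Context dT (T : measurableType dT) (R : realType).
Variables (nu : {finite_measure set T -> \bar R}).
Variables (la : {sigma_finite_measure set T -> \bar R}) (p : T -> R).
Hypotheses (mp : measurable_fun setT p)
  (nuE : forall U, measurable U -> nu U = (\int[la]_(x in U) (p x)%:E)%E).

(** Almost everywhere, p is the Radon-Nikodym derivative of nu. *)
Lemma density_integral D (f : T -> \bar R) : measurable D ->
  measurable_fun setT f -> (forall x, 0 <= f x)%E ->
  (\int[nu]_(x in D) f x = \int[la]_(x in D) (f x * (p x)%:E))%E.
Proof.
move=> mD mf f0.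
have nula : nu `<< la.
  move=> N Nla B mB BN; rewrite nuE//; apply: null_set_integral => //.
    by apply/measurable_EFinP; exact: measurable_funTS.
  exact: Nla.
rewrite -(@Radon_Nikodym_SigmaFinite.change_of_variables _ _ _ _ la)//; last first.
  exact: measurable_funTS.
have RNi := Radon_Nikodym_SigmaFinite.f_integrable nula.
apply: ae_eq_integral => //.
- apply: emeasurable_funM; first exact: measurable_funTS.
  exact: measurable_funTS (measurable_int _ RNi).
- apply: emeasurable_funM; first exact: measurable_funTS.
  by apply/measurable_EFinP; exact: measurable_funTS.
apply: ae_eqe_mul2l; apply: integral_ae_eq => //.
- exact: integrableS RNi.
- by apply/measurable_EFinP; exact: measurable_funTS.
- by move=> E _ mE; rewrite -Radon_Nikodym_SigmaFinite.f_integral// nuE.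
Qed.

End Density.

Section CondProb.
Context (R : realType) dO (Omega : measurableType dO) (P : probability Omega R).
Variables (d : nat) (X : {RV P >-> d.-tuple R}) (p : d.-tuple R -> R).
Hypotheses (mp : measurable_fun setT p) (p0 : forall x, 0 <= p x).
Hypothesis Xp : forall U, measurable U ->
  distribution P X U = (\int[lebesgue_tuple R d]_(x in U) (p x)%:E)%E.

Definition subtup (S : {set 'I_d}) (x : d.-tuple R) : #|S|.-tuple R :=
  [tuple tnth x (enum_val k) | k < #|S|].

(** A measurable section of [subtup]: composing with it makes a function of the
    coordinates in S factor through [subtup]. *)
Definition extup (S : {set 'I_d}) (z : #|S|.-tuple R) : d.-tuple R :=
  [tuple if [pick k | enum_val k == i] is Some k then tnth z k else 0 | i < d].

Lemma measurable_subtup (S : {set 'I_d}) : measurable_fun setT (subtup S).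
Proof.
apply/measurable_fun_tnthP => k.
rewrite (_ : _ \o _ = fun x : d.-tuple R => tnth x (enum_val k)); last first.
  by apply/funext => x /=; rewrite tnth_mktuple.
exact: measurable_tnth.
Qed.

Lemma measurable_extup (S : {set 'I_d}) : measurable_fun setT (@extup S).
Proof.
apply/measurable_fun_tnthP => i.
rewrite (_ : _ \o _ = fun z : #|S|.-tuple R =>
   if [pick k | enum_val k == i] is Some k then tnth z k else 0); last first.
  by apply/funext => x /=; rewrite tnth_mktuple.
by case: pickP => [k _|_]; [exact: measurable_tnth|exact: measurable_cst].
Qed.

Lemma extupK (S : {set 'I_d}) x i : i \in S -> tnth (extup (subtup S x)) i = tnth x i.
Proof.
move=> iS; rewrite tnth_mktuple; case: pickP => [k /eqP ki|].
  by rewrite tnth_mktuple ki.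
by move=> /(_ (enum_rank_in iS i)); rewrite enum_rankK_in// eqxx.
Qed.

Lemma mnneg_indic_p E : measurable E -> mnneg (fun x => (\1_E x * p x)%:E).
Proof.
move=> mE; split; last by move=> x; rewrite lee_fin mulr_ge0.
by apply/measurable_EFinP; apply: measurable_funM => //; exact: measurable_indic.
Qed.

Lemma mnneg_p : mnneg (EFin \o p).
Proof. by split; [exact/measurable_EFinP|move=> x; rewrite lee_fin]. Qed.

Lemma subtup_upd (S : {set 'I_d}) x i t : i \notin S ->
  subtup S (upd_coord x i t) = subtup S x.
Proof.
move=> iS; apply: eq_from_tnth => k; rewrite !tnth_mktuple.
by case: eqP => // ik; rewrite -ik enum_valP in iS.
Qed.

Variable C : {set 'I_d}.
Let s : seq 'I_d := enum (~: C).
Let nT := coord_ints s (EFin \o p).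
Hypothesis nT0 : forall x, (0 < nT x < +oo)%E.

Definition cond_num (E : set (d.-tuple R)) := coord_ints s (fun x => (\1_E x * p x)%:E).

(** The elementary conditional probability of E given the coordinates in C:
    the mass of E in the fibre of x, divided by the mass of the fibre. *)
Definition cond (E : set (d.-tuple R)) (x : d.-tuple R) : R :=
  fine (cond_num E x) / fine (nT x).

Lemma cond_num_le E x : measurable E -> (0 <= cond_num E x <= nT x)%E.
Proof.
move=> mE; have mI := mnneg_indic_p mE; apply/andP; split; first exact: coord_ints_ge0.
apply: coord_ints_le; [exact: mnneg_indic_p|exact: mnneg_p|move=> y].
by rewrite lee_fin ler_piMl// indicE; case: (_ \in _).
Qed.

Lemma nT_fin x : nT x \is a fin_num.
Proof. by have /andP[a b] := nT0 x; rewrite ge0_fin_numE// ltW. Qed.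

Lemma cond_num_fin E x : measurable E -> cond_num E x \is a fin_num.
Proof.
move=> mE; have /andP[a b] := cond_num_le x mE; have /andP[_ c] := nT0 x.
by rewrite ge0_fin_numE// (le_lt_trans b).
Qed.

Lemma fnT_gt0 x : 0 < fine (nT x).
Proof. exact: fine_gt0. Qed.

Lemma cond_bound E x : measurable E -> 0 <= cond E x <= 1.
Proof.
move=> mE; have /andP[a b] := cond_num_le x mE; have c := fnT_gt0 x.
apply/andP; split; first by apply: divr_ge0; [exact: fine_ge0|exact: ltW].
by rewrite ler_pdivrMr// mul1r; apply: fine_le => //; [exact: cond_num_fin|exact: nT_fin].
Qed.

Lemma cond_indep_of E : indep_of s (cond E).
Proof. by move=> x i t si; rewrite /cond /nT /cond_num !coord_ints_indep. Qed.

Lemma measurable_cond E : measurable E -> measurable_fun setT (cond E).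
Proof.
move=> mE; apply: measurable_funM.
  by apply: measurableT_comp => //; exact: (mnneg_coord_ints s (mnneg_indic_p mE)).1.
(* The inverse of a positive function, written exp o opp o ln *)
rewrite (_ : (fun x => _) = (fun x => expR (- ln (fine (nT x))))); last first.
  by apply/funext => x; rewrite expRN lnK// posrE fnT_gt0.
apply: (measurableT_comp (@measurable_expR R)).
apply: (measurableT_comp (@oppr_measurable R setT)).
apply: (measurableT_comp (@measurable_ln R)).
by apply: measurableT_comp => //; exact: (mnneg_coord_ints s mnneg_p).1.
Qed.

Lemma cond_factor E x : cond E x = cond E (extup (subtup C x)).
Proof.
apply: (indep_of_eq (@cond_indep_of E)) => i; rewrite mem_enum !inE negbK => iC.
by rewrite extupK.
Qed.

Lemma cond_nT E x : measurable E -> ((cond E x)%:E * nT x = cond_num E x)%E.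
Proof.
move=> mE; rewrite -[in LHS](fineK (nT_fin x)) -EFinM divfK ?fineK ?cond_num_fin//.
exact: lt0r_neq0 (fnT_gt0 x).
Qed.

Lemma measurable_factor (h : #|C|.-tuple R -> R) : measurable_fun setT h ->
  measurable_fun [set: g_sigma_algebra_preimageType (subvec X C)] (h \o subvec X C).
Proof.
move=> mh _ Y mY; exists (h @^-1` Y); last by [].
by rewrite -[X in measurable X]setTI; exact: mh.
Qed.

(** Integrate the coordinates outside C first. A function of the coordinates in
    C goes out of this inner integral, and the ratio times the mass of the fibre
    is the mass of E in the fibre. *)
Lemma is_cond_prob_cond E : measurable E ->
  is_cond_prob P (subvec X C) (X @^-1` E) (cond E \o X).
Proof.
move=> mE; have mc := measurable_cond mE.
split.
- rewrite (_ : cond E \o X = (cond E \o @extup C) \o subvec X C).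
    by apply: measurable_factor; apply: measurableT_comp => //; exact: measurable_extup.
  by apply/funext => w /=; rewrite cond_factor.
- apply: measurable_bounded_integrable => //.
  + exact: (le_lt_trans (probability_le1 P measurableT) (ltry _)).
  + exact: measurableT_comp.
  + exists 1; split => // M M1 w _ /=; have /andP[a b] := cond_bound (X w) mE.
    by rewrite ger0_norm// (le_trans b)// ltW.
- move=> W [V mV] <-; rewrite setTI.
  pose V' := subtup C @^-1` V.
  have mV' : measurable V'.
    by rewrite -[V']setTI; exact: (measurable_subtup (S := C)).
  have -> : subvec X C @^-1` V = X @^-1` V' by [].
  have mcE : mnneg (EFin \o cond E).
    split; first by apply/measurable_EFinP.
    by move=> x; rewrite lee_fin; case/andP: (cond_bound x mE).
  transitivity (\int[distribution P X]_(x in V') (cond E x)%:E)%E.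
    by rewrite ge0_integral_pushforward//; 
      [apply: measurable_funTS; exact: mcE.1|move=> x _; exact: mcE.2].
  rewrite (density_integral (la := lebesgue_tuple R d) (p := p))//; [|exact: mcE.1|exact: mcE.2].
  rewrite -preimage_setI -/(pushforward P X _) -/(distribution P X _) Xp; last exact: measurableI.
  pose x0 : d.-tuple R := [tuple 0 | i < d].
  have prm : perm_eq (enum 'I_d) (enum C ++ s).
    apply: uniq_perm; rewrite ?enum_uniq// ?cat_uniq ?enum_uniq/= ?andbT.
      by apply/hasPn => i; rewrite !mem_enum !inE.
    by move=> i; rewrite mem_cat !mem_enum !inE orbN.
  have mI : mnneg (fun x : d.-tuple R => (\1_V' x : R)%:E).
    by split; [apply/measurable_EFinP; exact: measurable_indic|move=> x; rewrite lee_fin].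
  have iV : indep_of s (fun x : d.-tuple R => (\1_V' x : R)%:E).
    move=> x i t si; rewrite !indicE; congr (_%:R%:E).
    congr (nat_of_bool _); apply/idP/idP; rewrite !inE /V'/=;
      by rewrite subtup_upd//; move: si; rewrite mem_enum !inE.
  pose r x := ((\1_V' x)%:E * (cond E x)%:E)%E.
  have mr : mnneg r.
    split; last by move=> x; apply: mule_ge0; [exact: mI.2|exact: mcE.2].
    by apply: emeasurable_funM; [exact: mI.1|exact: mcE.1].
  have ir : indep_of s r by move=> x i t si; rewrite /r iV// cond_indep_of.
  transitivity (coord_ints (enum C) (coord_ints s (fun x => r x * (p x)%:E)%E) x0).
    rewrite integral_mkcond -coord_ints_cat -(coord_ints_perm _ prm); last first.
      split; last by move=> x; apply: mule_ge0; [exact: mr.2|exact: mnneg_p.2].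
      by apply: emeasurable_funM; [exact: mr.1|exact: mnneg_p.1].
    rewrite -integral_coord_ints; last first.
      split; last by move=> x; apply: mule_ge0; [exact: mr.2|exact: mnneg_p.2].
      by apply: emeasurable_funM; [exact: mr.1|exact: mnneg_p.1].
    apply: eq_integral => x _; rewrite patchE /r indicE.
    by case: (x \in V'); rewrite ?mul1e ?mul0e.
  rewrite (coord_intsMl (r := r) mnneg_p mr ir).
  rewrite (_ : (fun x => r x * _)%E = (fun x => (\1_V' x)%:E * cond_num E x)%E); last first.
    by apply/funext => x; rewrite /r -muleA cond_nT.
  rewrite -(coord_intsMl (mnneg_indic_p mE) mI iV) -coord_ints_cat.
  have mIE : mnneg (fun x => (\1_V' x)%:E * (\1_E x * p x)%:E)%E.
    split; last by move=> x; apply: mule_ge0; [exact: mI.2|exact: (mnneg_indic_p mE).2].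
    by apply: emeasurable_funM; [exact: mI.1|exact: (mnneg_indic_p mE).1].
  rewrite -(coord_ints_perm mIE prm) -integral_coord_ints// [RHS]integral_mkcond.
  apply: eq_integral => x _; rewrite patchE in_setI !indicE andbC.
  by case: (x \in V'); case: (x \in E); rewrite ?mul1e ?mul0e ?mul1r ?mul0r.
Qed.

End CondProb.

(** * Conditional independence under separation *)

Section Separation.
Variable R : realType.

Lemma coord_ints_split n a b (f g : n.-tuple R -> \bar R) : mnneg f -> mnneg g ->
  indep_of b f -> indep_of a g ->
  coord_ints (a ++ b) (fun x => f x * g x)%E = (fun x => coord_ints a f x * coord_ints b g x)%E.
Proof.
move=> mf mg fb ga; rewrite coord_ints_cat (coord_intsMl mg mf fb).
have cg : indep_of a (coord_ints b g) by exact: coord_ints_indep_keep.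
under eq_fun do rewrite muleC.
by rewrite (coord_intsMl mf (mnneg_coord_ints b mg) cg); apply/funext => x; rewrite muleC.
Qed.

Lemma qf_indep d (M : 'M[R]_d) (s : seq 'I_d) :
  (forall i j, i \in s -> M i j = 0 /\ M j i = 0) -> indep_of s (qf M).
Proof.
move=> M0 x i t si; apply: eq_bigr => j _; apply: eq_bigr => k _.
rewrite !tnth_upd; case: (eqVneq j i) => [->|_]; first by rewrite (M0 i k si).1 !mul0r.
by case: (eqVneq k i) => [->|//]; rewrite (M0 i j si).2 !mul0r.
Qed.

Lemma qfD d (M N : 'M[R]_d) x : qf (M + N) x = qf M x + qf N x.
Proof.
rewrite /qf -big_split/=; apply: eq_bigr => i _; rewrite -big_split/=.
by apply: eq_bigr => j _; rewrite mxE !mulrDl.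
Qed.

Lemma indic_indep d (S : {set 'I_d}) (U : set (#|S|.-tuple R)) (s : seq 'I_d) :
  (forall i, i \in s -> i \notin S) ->
  indep_of s (fun x : d.-tuple R => \1_(subtup S @^-1` U) x : R).
Proof.
move=> sS x i t /sS iS; rewrite !indicE; congr (nat_of_bool _)%:R.
by apply/idP/idP; rewrite !inE /= subtup_upd.
Qed.

(** When no entry of the matrix links A' and B', which together make up the
    complement of C, the Gaussian weight is a product of a function of the
    coordinates in A' and C by a function of those in B' and C. *)
Lemma cond_num_factor d (K : 'M[R]_d) (c s : R) (C A' B' : {set 'I_d})
    (E F : set (d.-tuple R)) :
  0 < c -> (A' :|: B' = ~: C)%SET -> [disjoint A' & B']%B ->
  (forall i j, i \in A' -> j \in B' -> K i j = 0 /\ K j i = 0) ->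
  measurable E -> measurable F ->
  indep_of (enum B') (fun x => \1_E x : R) ->
  indep_of (enum A') (fun x => \1_F x : R) ->
  exists f g, forall x,
    cond_num (gauss c s K) C (E `&` F) x = (f E x * g F x)%E /\
    cond_num (gauss c s K) C E x = (f E x * g setT x)%E /\
    cond_num (gauss c s K) C F x = (f setT x * g F x)%E /\
    coord_ints (enum (~: C)) (EFin \o gauss c s K) x = (f setT x * g setT x)%E.
Proof.
move=> c0 ABC dAB K0 mE mF iE iF.
(* M1 collects the entries with a row or a column in A', M2 the other ones. *)
pose M1 : 'M[R]_d := \matrix_(i, j) if (i \in A') || (j \in A') then K i j else 0.
pose M2 : 'M[R]_d := \matrix_(i, j) if (i \in A') || (j \in A') then 0 else K i j.
have KM : K = M1 + M2.
  by apply/matrixP => i j; rewrite !mxE; case: ifP => _; rewrite ?addr0 ?add0r.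
have dA i : i \in B' -> i \in A' = false.
  by move=> iB; apply/negbTE; move: dAB; rewrite disjoint_sym => /disjointFr->.
have i1 : indep_of (enum B') (qf M1).
  apply: qf_indep => i j; rewrite mem_enum => iB; rewrite !mxE (dA _ iB) /= orbF.
  by case: ifP => // jA; have [] := K0 _ _ jA iB.
have i2 : indep_of (enum A') (qf M2).
  by apply: qf_indep => i j; rewrite mem_enum => iA; rewrite !mxE iA orbT.
have gE x : gauss c s K x = gauss c s M1 x * gauss 1 s M2 x.
  by rewrite /gauss KM qfD mul1r -mulrA -expRD; congr (_ * expR _); ring.
have m1 E' : measurable E' -> mnneg (fun x => (\1_E' x * gauss c s M1 x)%:E).
  move=> mE'; apply: mnneg_indic_p => //; first exact: measurable_gauss.
  by move=> x; exact: ltW (gauss_gt0 _ _ _ _).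
have m2 E' : measurable E' -> mnneg (fun x => (\1_E' x * gauss 1 s M2 x)%:E).
  move=> mE'; apply: mnneg_indic_p => //; first exact: measurable_gauss.
  by move=> x; exact: ltW (gauss_gt0 _ _ _ _).
pose f E' := coord_ints (enum A') (fun x => (\1_E' x * gauss c s M1 x)%:E).
pose g E' := coord_ints (enum B') (fun x => (\1_E' x * gauss 1 s M2 x)%:E).
have prm : perm_eq (enum (~: C)) (enum A' ++ enum B').
  apply: uniq_perm; rewrite ?enum_uniq// ?cat_uniq ?enum_uniq/= ?andbT.
    by apply/hasPn => i; rewrite !mem_enum => /dA->.
  by move=> i; rewrite mem_cat !mem_enum -ABC inE.
have main E' F' : measurable E' -> measurable F' ->
    indep_of (enum B') (fun x => \1_E' x : R) ->
    indep_of (enum A') (fun x => \1_F' x : R) ->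
    forall x, coord_ints (enum (~: C)) (fun x => (\1_(E' `&` F') x * gauss c s K x)%:E) x =
    (f E' x * g F' x)%E.
  move=> mE' mF' iE' iF' x0; rewrite /f /g.
  rewrite (coord_ints_perm _ prm); last first.
    apply: mnneg_indic_p; [exact: measurable_gauss| |exact: measurableI].
    by move=> x; exact: ltW (gauss_gt0 _ _ _ c0).
  rewrite -[RHS](congr1 (@^~ x0) (coord_ints_split _ _ _ _)); [|exact: m1|exact: m2| |].
  - congr (coord_ints _ _ x0); apply/funext => x; rewrite -EFinM gE indicI/=; congr EFin; ring.
  - by move=> x i t iB; rewrite iE'// /gauss i1.
  - by move=> x i t iA; rewrite iF'// /gauss i2.
have iT l : indep_of l (fun x : d.-tuple R => \1_setT x : R).
  by move=> x i t _; rewrite !indicT.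
exists f, g => x; rewrite /cond_num; split; first by rewrite main.
split; first by rewrite -{1}[E]setIT main.
split; first by rewrite -{1}[F]setTI main.
rewrite -main// setIT; congr (coord_ints _ _ x).
by apply/funext => y; rewrite indicT mul1r.
Qed.

(** The factorizations of [cond_num_factor], multiplied crosswise. *)
Lemma cond_mul d (K : 'M[R]_d) (c s : R) (C A' B' : {set 'I_d})
    (E F : set (d.-tuple R)) x :
  0 < c -> (A' :|: B' = ~: C)%SET -> [disjoint A' & B']%B ->
  (forall i j, i \in A' -> j \in B' -> K i j = 0 /\ K j i = 0) ->
  (forall x, 0 < coord_ints (enum (~: C)) (EFin \o gauss c s K) x < +oo)%E ->
  measurable E -> measurable F ->
  indep_of (enum B') (fun x => \1_E x : R) ->
  indep_of (enum A') (fun x => \1_F x : R) ->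
  cond (gauss c s K) C (E `&` F) x =
  cond (gauss c s K) C E x * cond (gauss c s K) C F x.
Proof.
move=> c0 ABC dAB K0 nT mE mF iE iF.
have mK := measurable_gauss c s K.
have K_ge0 y : 0 <= gauss c s K y by exact: ltW (gauss_gt0 _ _ _ c0).
have nTf := nT_fin nT; have nTp := fnT_gt0 nT.
have cfin G y : measurable G -> cond_num (gauss c s K) C G y \is a fin_num.
  by move=> mG; exact: cond_num_fin.
have [f [g fg]] := cond_num_factor s c0 ABC dAB K0 mE mF iE iF.
have [EF [Ex [Fx Tx]]] := fg x.
have H : (cond_num (gauss c s K) C (E `&` F) x * coord_ints (enum (~: C)) (EFin \o gauss c s K) x =
  cond_num (gauss c s K) C E x * cond_num (gauss c s K) C F x)%E.
  by rewrite EF Tx Ex Fx muleACA [RHS]muleACA [(g F x * _)%E]muleC.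
move: H => /(congr1 fine); rewrite !fineM ?cfin//; last exact: measurableI.
move=> H; rewrite /cond mulf_div -H; have T0 := lt0r_neq0 (nTp x).
by field.
Qed.

End Separation.

(** * Uniqueness of conditional probabilities *)

Section Uniqueness.
Context (R : realType) dO (Omega : measurableType dO) (P : probability Omega R).
Context dT (T : measurableType dT) (Z : Omega -> T).
Hypothesis mZ : measurable_fun setT Z.

Lemma preimage_sub_measurable (W : set Omega) :
  g_sigma_algebra_preimage Z W -> measurable W.
Proof. by move=> [V mV <-]; exact: mZ. Qed.

(** The event W where f2 < f1 belongs to the conditioning sigma-algebra, so f1
    and f2 have the same integral over it, namely P (E `&` W). Hence f1 - f2,
    positive on W, vanishes almost everywhere on W. *)
Lemma cond_prob_le E f1 f2 : measurable E -> is_cond_prob P Z E f1 -> is_cond_prob P Z E f2 ->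
  {ae P, forall w, f1 w <= f2 w}.
Proof.
move=> mE [mf1 if1 f1E] [mf2 if2 f2E].
pose W := [set w | f2 w < f1 w].
have ZW : g_sigma_algebra_preimage Z W.
  have := @measurable_fun_ltr _ (g_sigma_algebra_preimageType Z) R setT f2 f1 mf2 mf1.
  have mt : measurable [set true] by [].
  move=> /(_ measurableT _ mt); rewrite setTI.
  by congr (measurable _); apply/seteqP; split => w /=.
have mW := preimage_sub_measurable ZW.
have if1W := integrableS measurableT mW (@subsetT _ _) if1.
have if2W := integrableS measurableT mW (@subsetT _ _) if2.
have I0 : (\int[P]_(w in W) `| (f1 w)%:E - (f2 w)%:E | = 0)%E.
  transitivity (\int[P]_(w in W) ((f1 w)%:E - (f2 w)%:E))%E.
    apply: eq_integral => w; rewrite inE => Ww; rewrite gee0_abs//.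
    by rewrite -EFinB lee_fin subr_ge0 ltW.
  rewrite integralB//; rewrite f1E// f2E// subee// fin_num_measure//.
  exact: measurableI.
have mf : measurable_fun W (fun w => (f1 w)%:E - (f2 w)%:E)%E.
  by apply: emeasurable_funB; [exact: measurable_int if1W|exact: measurable_int if2W].
have /(ae_eq_integral_abs P mW mf) ae0 := I0.
apply: filterS ae0 => w H; rewrite leNgt; apply/negP => f21.
have := H f21; rewrite -EFinB => -[] /eqP; rewrite subr_eq0 => /eqP f12.
by rewrite f12 ltxx in f21.
Qed.

Lemma cond_prob_unique E f1 f2 : measurable E -> is_cond_prob P Z E f1 -> is_cond_prob P Z E f2 ->
  {ae P, forall w, f1 w = f2 w}.
Proof.
move=> mE c1 c2; have := cond_prob_le mE c1 c2; have := cond_prob_le mE c2 c1.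
by apply: filterS2 => w f21 f12; apply/le_anti; rewrite f12.
Qed.

Lemma ae_probability_ex (Q : Omega -> Prop) : {ae P, forall w, Q w} -> exists w, Q w.
Proof.
move=> [N [mN N0 QN]]; apply: contrapT => nQ.
have : P setT = 0%E.
  apply/eqP; rewrite -measure_le0 -N0 le_measure ?inE//.
  by move=> w _; apply: QN => Qw; apply: nQ; exists w.
by rewrite probability_setT => /eqP; rewrite onee_eq0.
Qed.

End Uniqueness.

(** * Dependence created by a cross term *)

Section Quadrants.
Variable R : realType.
Local Notation mu := (@lebesgue_measure R).

Lemma integral_gt0 (f : R -> \bar R) A : measurable_fun setT f ->
  (forall t, 0 <= f t)%E -> measurable A -> (0 < mu A)%E ->
  (forall t, A t -> 0 < f t)%E -> (0 < \int[mu]_t f t)%E.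
Proof.
move=> mf f0 mA muA fA; rewrite lt0e integral_ge0 ?andbT//; apply/negP => /eqP I0.
have I1 : (\int[mu]_t `|f t| = 0)%E.
  by rewrite -I0; apply: eq_integral => t _; rewrite gee0_abs.
have /(ae_eq_integral_abs mu measurableT mf)[N [mN N0 sN]] := I1.
have : (mu A <= mu N)%E.
  apply: le_measure; rewrite ?inE// => t At; apply: sN => /= /(_ I) ft0.
  by have := fA t At; rewrite ft0 ltxx.
by rewrite N0 leNgt muA.
Qed.

Lemma iterated_integral_le (f g : R * R -> \bar R) :
  measurable_fun setT f -> measurable_fun setT g ->
  (forall z, 0 <= f z)%E -> (forall z, f z <= g z)%E ->
  (\int[mu]_s \int[mu]_t f (s, t) <= \int[mu]_s \int[mu]_t g (s, t))%E.
Proof.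
move=> mf mg f0 fg; have g0 z : (0 <= g z)%E := le_trans (f0 z) (fg z).
have sec (k : R * R -> \bar R) s : measurable_fun setT k ->
    measurable_fun [set: R] (fun t => k (s, t)).
  by move=> mk; exact: (measurableT_comp mk (@pair1_measurable _ _ _ _ s)).
apply: ge0_le_integral => //.
- by move=> s _; exact: integral_ge0.
- exact: (@measurable_fun_fubini_tonelli_F _ _ _ _ _ mu f).
- exact: (@measurable_fun_fubini_tonelli_F _ _ _ _ _ mu g).
- by move=> s _; apply: ge0_le_integral => //; exact: sec.
Qed.

Lemma iterated_integral_lt (f g : R * R -> \bar R) A B :
  measurable_fun setT f -> measurable_fun setT g ->
  (forall z, 0 <= f z)%E -> (forall z, f z <= g z)%E ->
  measurable A -> measurable B -> (0 < mu A)%E -> (0 < mu B)%E ->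
  (forall s t, A s -> B t -> f (s, t) < g (s, t))%E ->
  (forall z, f z \is a fin_num) ->
  (\int[mu]_s \int[mu]_t f (s, t) < +oo)%E ->
  (\int[mu]_s \int[mu]_t f (s, t) < \int[mu]_s \int[mu]_t g (s, t))%E.
Proof.
move=> mf mg f0 fg mA mB A0 B0 fgAB ff ffin.
pose h z := (g z - f z)%E.
have mh : measurable_fun setT h by exact: emeasurable_funB.
have h0 z : (0 <= h z)%E by rewrite sube_ge0// ff.
have gE z : (g z = f z + h z)%E by rewrite /h addeC subeK.
have sec (k : R * R -> \bar R) s : measurable_fun setT k ->
    measurable_fun [set: R] (fun t => k (s, t)).
  by move=> mk; exact: (measurableT_comp mk (@pair1_measurable _ _ _ _ s)).
have tot (k : R * R -> \bar R) : measurable_fun setT k -> (forall z, 0 <= k z)%E ->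
    measurable_fun [set: R] (fun s => \int[mu]_t k (s, t))%E.
  by move=> mk k0; exact: (@measurable_fun_fubini_tonelli_F _ _ _ _ _ mu k).
have -> : (\int[mu]_s \int[mu]_t g (s, t) =
    \int[mu]_s \int[mu]_t f (s, t) + \int[mu]_s \int[mu]_t h (s, t))%E.
  rewrite -ge0_integralD//; [|by move=> s _; exact: integral_ge0|exact: tot
     |by move=> s _; exact: integral_ge0|exact: tot].
  apply: eq_integral => s _; rewrite -ge0_integralD//; [|exact: sec|exact: sec].
  by apply: eq_integral => t _.
have ge0 : (0 <= \int[mu]_s \int[mu]_t f (s, t))%E.
  by apply: integral_ge0 => s _; exact: integral_ge0.
rewrite lteDl ?ge0_fin_numE//.
apply: (@integral_gt0 _ A) => //; first exact: tot.
  by move=> s; exact: integral_ge0.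
move=> s As; apply: (@integral_gt0 _ B) => //; first exact: sec.
by move=> t Bt; rewrite /h sube_gt0 fgAB.
Qed.

(** The masses m1, m2, m3, m4 of the quadrants (+,+), (+,-), (-,+), (-,-) are
    compared with those of a product weight, for which both products of opposite
    quadrants are wp un wn up. *)
Lemma quadrant_products (m1 m2 m3 m4 wp wn up un : \bar R) :
  (0 < wp)%E -> (0 < wn)%E -> (0 < up)%E -> (0 < un)%E ->
  (0 <= m2)%E -> (0 <= m3)%E -> (m1 < +oo)%E -> (m4 < +oo)%E ->
  (wp * up < m1)%E -> (wn * un < m4)%E ->
  (m2 <= wp * un)%E -> (m3 <= wn * up)%E -> (m2 * m3 < m1 * m4)%E.
Proof.
move=> wp0 wn0 up0 un0 m20 m30 m1oo m4oo m1l m4l m2l m3l.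
have finp (a b c : \bar R) : (0 < a)%E -> (0 < b)%E -> (a * b < c)%E ->
    a \is a fin_num /\ b \is a fin_num.
  move: a b => [a| |] [b| |] //= a0 b0.
  - by rewrite mulry gtr0_sg// mul1e ltNge leey.
  - by rewrite mulyr gtr0_sg// mul1e ltNge leey.
  - by rewrite mulyy ltNge leey.
have [wpf upf] := finp _ _ _ wp0 up0 m1l; have [wnf unf] := finp _ _ _ wn0 un0 m4l.
move: wp wn up un wpf upf wnf unf wp0 wn0 up0 un0 m1l m4l m2l m3l.
move=> [wp| |] [wn| |] [up| |] [un| |] // _ _ _ _.
rewrite !lte_fin => wp0 wn0 up0 un0 m1l m4l m2l m3l.
have {}m1l : ((wp * up)%:E < m1)%E := m1l.
have {}m4l : ((wn * un)%:E < m4)%E := m4l.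
have {}m2l : (m2 <= (wp * un)%:E)%E := m2l.
have {}m3l : (m3 <= (wn * up)%:E)%E := m3l.

move: m1 m2 m3 m4 m1oo m4oo m20 m30 m1l m4l m2l m3l => [m1| |] [m2| |] [m3| |] [m4| |] //= _ _.
rewrite !lee_fin !lte_fin => m20 m30 m1l m4l m2l m3l.
suff : ((m2 * m3)%:E < (m1 * m4)%:E)%E by []; rewrite lte_fin.
apply: (@le_lt_trans _ _ ((wp * un) * (wn * up))); first exact: ler_pM.
rewrite (_ : _ * _ = (wp * up) * (wn * un)); last by ring.
by apply: ltr_pM => //; rewrite mulr_ge0// ltW.
Qed.

Definition halfline (b : bool) : set R := if b then [set s | 0 <= s] else [set s | s < 0].

Lemma measurable_halfline b : measurable (halfline b).
Proof.
case: b; rewrite /halfline.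
- by have := measurable_itv `[(0 : R), +oo[; rewrite set_itvE; congr measurable.
- by have := measurable_itv `]-oo, (0 : R)[; rewrite set_itvE; congr measurable.
Qed.

(** A part of positive measure of each half-line, away from 0, where the
    comparison of weights is strict. *)
Definition halfunit (b : bool) : set R := if b then `]0, 1[%classic else `]-1, 0[%classic.

Lemma measurable_halfunit b : measurable (halfunit b).
Proof. by case: b; exact: measurable_itv. Qed.

Lemma halfunit_gt0 b : (0 < mu (halfunit b))%E.
Proof.
by case: b; rewrite /halfunit lebesgue_measure_itv/= lte_fin ?ltr01 ?ltrN10 -EFinD lte_fin; lra.
Qed.

Lemma halfunit_sub b s : halfunit b s -> halfline b s /\ s != 0.
Proof.
case: b; rewrite /halfunit/halfline/= in_itv/= => /andP[a c].
  by rewrite ltW// gt_eqF.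
by rewrite c lt_eqF.
Qed.

Section CrossTerm.
Variables (w u : R -> R) (theta : R).
Hypotheses (mw : measurable_fun setT w) (mu_ : measurable_fun setT u).
Hypotheses (w0 : forall s, 0 < w s) (u0 : forall t, 0 < u t).

Let ind2 b c (z : R * R) : R := \1_(halfline b) z.1 * \1_(halfline c) z.2.

(** The mass of a quadrant for a product weight perturbed by a cross term. *)
Definition quadrant b c : \bar R :=
  (\int[mu]_s \int[mu]_t (ind2 b c (s, t) * (w s * u t * expR (theta * s * t)))%:E)%E.

Let W b := (\int[mu]_s (\1_(halfline b) s * w s)%:E)%E.
Let U b := (\int[mu]_s (\1_(halfline b) s * u s)%:E)%E.

Let line_gt0 (v : R -> R) b : measurable_fun setT v -> (forall s, 0 < v s) ->
  (0 < \int[mu]_s (\1_(halfline b) s * v s)%:E)%E.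
Proof.
move=> mv v0; apply: (@integral_gt0 _ (halfunit b)).
- apply/measurable_EFinP; apply: measurable_funM => //.
  by apply: measurable_indic; exact: measurable_halfline.
- by move=> t; rewrite lee_fin mulr_ge0// ltW.
- exact: measurable_halfunit.
- exact: halfunit_gt0.
- by move=> t /halfunit_sub[hb _]; rewrite lte_fin indicE mem_set// mul1r.
Qed.

Let measurable_ind2 b c : measurable_fun setT (ind2 b c).
Proof.
apply: measurable_funM.
  apply: (measurableT_comp (f := \1_(halfline b) : R -> R)) => //.
  by apply: measurable_indic; exact: measurable_halfline.
apply: (measurableT_comp (f := \1_(halfline c) : R -> R)) => //.
by apply: measurable_indic; exact: measurable_halfline.
Qed.

Let measurable_wu : measurable_fun setT (fun z : R * R => w z.1 * u z.2).
Proof. by apply: measurable_funM; exact: measurableT_comp. Qed.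

Let measurable_psi :
  measurable_fun setT (fun z : R * R => w z.1 * u z.2 * expR (theta * z.1 * z.2)).
Proof.
apply: measurable_funM; first exact: measurable_wu.
apply: (measurableT_comp (@measurable_expR R)); apply: measurable_funM => //.
by apply: measurable_funM => //; exact: measurable_cst.
Qed.

Let ind2_ge0 b c z : 0 <= ind2 b c z. Proof. by rewrite mulr_ge0. Qed.

Let prodE b c : (\int[mu]_s \int[mu]_t (ind2 b c (s, t) * (w s * u t))%:E = W b * U c)%E.
Proof.
have mU : measurable_fun [set: R] (fun t => (\1_(halfline c) t * u t)%:E).
  apply/measurable_EFinP; apply: measurable_funM => //.
  by apply: measurable_indic; exact: measurable_halfline.
have mW : measurable_fun [set: R] (fun t => (\1_(halfline b) t * w t)%:E).
  apply/measurable_EFinP; apply: measurable_funM => //.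
  by apply: measurable_indic; exact: measurable_halfline.
transitivity (\int[mu]_s ((\1_(halfline b) s * w s)%:E * U c))%E.
  apply: eq_integral => s _; rewrite -ge0_integralZl//.
  - by apply: eq_integral => t _; rewrite -EFinM /ind2/=; congr EFin; ring.
  - by move=> t _; rewrite lee_fin mulr_ge0// ltW.
  - by rewrite lee_fin mulr_ge0// ltW.
rewrite ge0_integralZr//.
- by move=> t _; rewrite lee_fin mulr_ge0// ltW.
- exact: ltW (line_gt0 _ _ _).
Qed.

Let prod_lt_quadrant b c : theta != 0 -> (quadrant b c < +oo)%E ->
  (forall s t, halfline b s -> halfline c t -> 0 <= theta * s * t) ->
  (W b * U c < quadrant b c)%E.
Proof.
move=> th0 qoo th; rewrite -prodE.
have fg (z : R * R) : ((ind2 b c z * (w z.1 * u z.2))%:E <=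
    (ind2 b c z * (w z.1 * u z.2 * expR (theta * z.1 * z.2)))%:E)%E.
  rewrite lee_fin; have [[hb hc]|nh] := pselect (halfline b z.1 /\ halfline c z.2).
    rewrite ler_wpM2l// ler_peMr//; first by rewrite mulr_ge0// ltW.
    by rewrite -expR0 ler_expR th.
  suff -> : ind2 b c z = 0 by rewrite !mul0r.
  rewrite /ind2 !indicE; have [hb|_] := boolP (z.1 \in halfline b); last by rewrite mul0r.
  have [hc|_] := boolP (z.2 \in halfline c); last by rewrite mulr0.
  by exfalso; apply: nh; split; exact/set_mem.
have mf : measurable_fun setT (fun z : R * R => (ind2 b c z * (w z.1 * u z.2))%:E).
  by apply/measurable_EFinP; apply: measurable_funM.
have mg : measurable_fun setT (fun z : R * R =>
    (ind2 b c z * (w z.1 * u z.2 * expR (theta * z.1 * z.2)))%:E).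
  by apply/measurable_EFinP; apply: measurable_funM.
apply: (@iterated_integral_lt (fun z => (ind2 b c z * (w z.1 * u z.2))%:E)
  (fun z => (ind2 b c z * (w z.1 * u z.2 * expR (theta * z.1 * z.2)))%:E)
  (halfunit b) (halfunit c)) => //.
- by move=> z; rewrite lee_fin mulr_ge0// mulr_ge0// ltW.
- exact: measurable_halfunit.
- exact: measurable_halfunit.
- exact: halfunit_gt0.
- exact: halfunit_gt0.
- move=> s t /halfunit_sub[hb s0] /halfunit_sub[hc t0] /=.
  rewrite lte_fin /ind2/= !indicE !mem_set// !mul1r ltr_pMr; last by rewrite mulr_gt0.
  by rewrite -expR0 ltr_expR lt0r th// !mulf_neq0.
- rewrite (le_lt_trans _ qoo)//.
  apply: (@iterated_integral_le (fun z => (ind2 b c z * (w z.1 * u z.2))%:E)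
    (fun z => (ind2 b c z * (w z.1 * u z.2 * expR (theta * z.1 * z.2)))%:E)) => //.
  by move=> z; rewrite lee_fin mulr_ge0// mulr_ge0// ltW.
Qed.

Let quadrant_le_prod b c :
  (forall s t, halfline b s -> halfline c t -> theta * s * t <= 0) ->
  (quadrant b c <= W b * U c)%E.
Proof.
move=> th; rewrite -prodE.
apply: (@iterated_integral_le
  (fun z => (ind2 b c z * (w z.1 * u z.2 * expR (theta * z.1 * z.2)))%:E)
  (fun z => (ind2 b c z * (w z.1 * u z.2))%:E)).
- by apply/measurable_EFinP; apply: measurable_funM.
- by apply/measurable_EFinP; apply: measurable_funM.
- by move=> z; rewrite lee_fin mulr_ge0// mulr_ge0 ?expR_ge0// mulr_ge0// ltW.
move=> z; rewrite lee_fin; have [[hb hc]|nh] := pselect (halfline b z.1 /\ halfline c z.2).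
  rewrite ler_wpM2l// ler_piMr//; first by rewrite mulr_ge0// ltW.
  by rewrite -expR0 ler_expR th.
suff -> : ind2 b c z = 0 by rewrite !mul0r.
rewrite /ind2 !indicE; have [hb|_] := boolP (z.1 \in halfline b); last by rewrite mul0r.
have [hc|_] := boolP (z.2 \in halfline c); last by rewrite mulr0.
by exfalso; apply: nh; split; exact/set_mem.
Qed.

Let quadrant_ge0 b c : (0 <= quadrant b c)%E.
Proof.
apply: integral_ge0 => s _; apply: integral_ge0 => t _.
by rewrite lee_fin mulr_ge0// mulr_ge0 ?expR_ge0// mulr_ge0// ltW.
Qed.

(** Compared with the product weight, the cross term increases the masses of two
    opposite quadrants and decreases those of the other two. *)
Lemma quadrants_dependent : theta != 0 -> (forall b c, quadrant b c < +oo)%E ->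
  (quadrant true true * quadrant false false !=
   quadrant true false * quadrant false true)%E.
Proof.
move=> th0 qoo.
have Wp b : (0 < W b)%E by exact: line_gt0.
have Up b : (0 < U b)%E by exact: line_gt0.
have [thp|thn|thE] := ltgtP theta 0; last by rewrite thE eqxx in th0.
- rewrite neq_lt; apply/orP; left.
  apply: (quadrant_products (wp := W true) (wn := W false) (up := U false) (un := U true)) => //.
  + by apply: prod_lt_quadrant => // s t s0 t0; rewrite mulr_le0// ?mulr_le0_ge0// ltW.
  + by apply: prod_lt_quadrant => // s t s0 t0; rewrite mulr_ge0// mulr_le0// ltW.
  + by apply: quadrant_le_prod => // s t s0 t0; rewrite mulr_le0_ge0// mulr_le0_ge0// ltW.
  + by apply: quadrant_le_prod => // s t s0 t0; rewrite mulr_ge0_le0// ?mulr_le0// ltW.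
- rewrite neq_lt; apply/orP; right.
  apply: (quadrant_products (wp := W true) (wn := W false) (up := U true) (un := U false)) => //.
  + by apply: prod_lt_quadrant => // s t s0 t0; rewrite mulr_ge0// mulr_ge0// ltW.
  + by apply: prod_lt_quadrant => // s t s0 t0; rewrite mulr_le0// ?mulr_ge0_le0// ltW.
  + by apply: quadrant_le_prod => // s t s0 t0; rewrite mulr_ge0_le0// ?mulr_ge0// ltW.
  + by apply: quadrant_le_prod => // s t s0 t0; rewrite mulr_le0_ge0// mulr_ge0_le0// ltW.
Qed.

End CrossTerm.

End Quadrants.

(** * Gaussian dependence given a set of coordinates *)

Section Dependence.
Variable R : realType.
Local Notation mu := (@lebesgue_measure R).

Lemma coord_intsD n s (f g : n.-tuple R -> \bar R) : mnneg f -> mnneg g ->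
  coord_ints s (fun x => f x + g x)%E = (fun x => coord_ints s f x + coord_ints s g x)%E.
Proof.
move=> mf mg; elim: s => //= i s ->; apply/funext => x; rewrite /coord_int.
have mf' := mnneg_coord_ints s mf; have mg' := mnneg_coord_ints s mg.
rewrite ge0_integralD//.
- by move=> t _; exact: mf'.2.
- exact: mnneg_upd.
- by move=> t _; exact: mg'.2.
- exact: mnneg_upd.
Qed.

Lemma gauss_marginal_bounds d (K : 'M[R]_d) (c s : R) l x :
  symmx K -> pd_on finset.setT K -> 0 < c -> 0 < s -> uniq l ->
  (0 < coord_ints l (EFin \o gauss c s K) x < +oo)%E.
Proof.
move=> sK pK c0 s0 ul.
have [c1 [s1 [c10 s10 ->]]] := coord_ints_gauss sK pK ul (fun i _ => finset.in_setT i) c0 s0.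
by rewrite /= lte_fin gauss_gt0// ltry.
Qed.

(** The mixed difference of the form in two coordinates isolates the cross
    term. *)
Lemma qf_upd2 d (K : 'M[R]_d) x a b s t : symmx K -> 0 < K b b -> a != b ->
  qf K (upd_coord (upd_coord x a s) b t) = qf K (upd_coord (upd_coord x a s) b 0) +
    qf K (upd_coord (upd_coord x a 0) b t) - qf K (upd_coord (upd_coord x a 0) b 0) +
    2 * K a b * s * t.
Proof.
move=> sK Kb ab; have Kb0 := lt0r_neq0 Kb.
have qE v r := qf_updE (upd_coord x a v) r sK Kb0; rewrite !qE.
pose l v := \sum_(j | j != b) K b j * tnth (upd_coord x a v) j.
have lE v : l v = l 0 + K a b * v.
  rewrite /l (bigD1 a)//= [in RHS](bigD1 a)//= !updE mulr0 add0r addrC sK.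
  congr (_ + _); apply: eq_bigr => j /andP[_ /negPf ja].
  by rewrite !tnth_upd ja.
rewrite -/(l s) -/(l 0) lE; field.
exact: Kb0.
Qed.

Definition halfspace d (a : 'I_d) (b : bool) : set (d.-tuple R) :=
  [set x | halfline b (tnth x a)].

Lemma measurable_halfspace d (a : 'I_d) b : measurable (halfspace a b).
Proof.
rewrite -[halfspace a b]setTI; apply: (@measurable_tnth _ R d a) => //.
exact: measurable_halfline.
Qed.

Lemma indic_halfspace d (a : 'I_d) b x :
  \1_(halfspace a b) x = \1_(halfline b) (tnth x a) :> R.
Proof. by rewrite !indicE; congr (nat_of_bool _)%:R; apply/idP/idP; rewrite !inE. Qed.

Lemma indic_halfspace_split d (a : 'I_d) x :
  \1_(halfspace a true) x + \1_(halfspace a false) x = 1 :> R.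
Proof.
rewrite !indic_halfspace !indicE; have [h|h] := leP 0 (tnth x a).
  by rewrite mem_set//= memNset ?addr0//= /halfline/= ltNge h.
by rewrite memNset//= ?mem_set ?add0r//= /halfline/= leNgt h.
Qed.

(** Fix the coordinates in C. Once those other than a and b are integrated out,
    the weight of (x_a, x_b) has the form treated in [quadrants_dependent], and
    theta is a nonzero multiple of the entry (a, b) of the eliminated matrix. A
    product formula for the half-spaces would say that both products of masses
    of opposite quadrants agree. *)
Lemma gauss_halfspaces_dependent d (K : 'M[R]_d) (c s : R) (C : {set 'I_d}) a b x :
  symmx K -> pd_on finset.setT K -> 0 < c -> 0 < s -> a != b -> a \notin C -> b \notin C ->
  pivots (enum (~: C :\ a :\ b)%SET) K a b != 0 ->
  cond (gauss c s K) C (halfspace a true `&` halfspace b true) x !=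
  cond (gauss c s K) C (halfspace a true) x * cond (gauss c s K) C (halfspace b true) x.
Proof.
move=> sK pK c0 s0 ab aC bC Kab; set l := enum _ in Kab.
have prm : perm_eq (enum (~: C)) [:: a, b & l].
  apply: uniq_perm; rewrite ?enum_uniq//=.
    by rewrite !inE negb_or !mem_enum !inE !eqxx/= andbF enum_uniq ab.
  move=> i; rewrite !inE !mem_enum !inE.
  case: (eqVneq i a) => [->|_]; first by rewrite aC.
  by case: (eqVneq i b) => [->|_]; first by rewrite bC.
have ul : uniq l by exact: enum_uniq.
have [c1 [s1 [c10 s10 mE]]] := coord_ints_gauss sK pK ul (fun i _ => finset.in_setT i) c0 s0.
pose K' := pivots l K.
have sK' : symmx K' by exact: pivots_symm.
have Kb : 0 < K' b b.
  apply: (pd_on_diag (pd_on_pivots sK pK ul (fun i _ => finset.in_setT i))).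
  by rewrite !inE mem_enum !inE eqxx.
(* The value of the form at the origin of the (a, b)-plane is contained in the
   exponents of both w and u, hence the compensating constant in u. *)
pose w v := gauss c1 s1 K' (upd_coord (upd_coord x a v) b 0).
pose u t := gauss (expR (s1 * qf K' (upd_coord (upd_coord x a 0) b 0))) s1 K'
  (upd_coord (upd_coord x a 0) b t).
pose theta := - (2 * s1 * K' a b).
have psiE v t : gauss c1 s1 K' (upd_coord (upd_coord x a v) b t) = w v * u t * expR (theta * v * t).
  rewrite /w /u /gauss qf_upd2// -!mulrA -!expRD; congr (_ * expR _).
  by rewrite /theta; ring.
pose Q := quadrant w u theta.
have mgK := measurable_gauss c s K.
have gK0 y : 0 <= gauss c s K y by exact: ltW (gauss_gt0 _ _ _ c0).
have mH v e : measurable (halfspace a v `&` halfspace b e).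
  by apply: measurableI; exact: measurable_halfspace.
have QE v e : cond_num (gauss c s K) C (halfspace a v `&` halfspace b e) x = Q v e.
  rewrite /cond_num (coord_ints_perm _ prm); last exact: mnneg_indic_p.
  rewrite -[[:: a, b & l]]/([:: a; b] ++ l) coord_ints_cat.
  have mI : mnneg (fun y : d.-tuple R => (\1_(halfspace a v `&` halfspace b e) y : R)%:E).
    by split; [apply/measurable_EFinP; exact: measurable_indic|move=> y; rewrite lee_fin].
  have iI : indep_of l (fun y : d.-tuple R => (\1_(halfspace a v `&` halfspace b e) y : R)%:E).
    move=> y i r; rewrite mem_enum !inE => /and3P[ib ia _].
    by rewrite !indicI/= !indic_halfspace !tnth_upd eq_sym (negPf ia) eq_sym (negPf ib).
  rewrite (coord_intsMl (F := EFin \o gauss c s K) (mnneg_gauss s K c0) mI iI) mE /=.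
  apply: eq_integral => r _; apply: eq_integral => t _.
  rewrite -EFinM -psiE indicI/= !indic_halfspace updE tnth_upd (negPf ab) updE.
  by [].
pose p1 E (y : d.-tuple R) := (\1_E y * gauss c s K y)%:E.
have mp1 E : measurable E -> mnneg (p1 E) by move=> mE'; exact: mnneg_indic_p.
have EE e : cond_num (gauss c s K) C (halfspace a e) x = (Q e true + Q e false)%E.
  rewrite -!QE -(congr1 (@^~ x) (coord_intsD _ (mp1 _ (mH e true)) (mp1 _ (mH e false)))).
  congr (coord_ints _ _ x); apply/funext => y; rewrite /p1 -EFinD; congr EFin.
  by rewrite !indicI/= -mulrDl -mulrDr indic_halfspace_split mulr1.
have FE : cond_num (gauss c s K) C (halfspace b true) x = (Q true true + Q false true)%E.
  rewrite -!QE -(congr1 (@^~ x) (coord_intsD _ (mp1 _ (mH true true)) (mp1 _ (mH false true)))).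
  congr (coord_ints _ _ x); apply/funext => y; rewrite /p1 -EFinD; congr EFin.
  by rewrite !indicI/= -mulrDl -mulrDl indic_halfspace_split mul1r.
have TE : coord_ints (enum (~: C)) (EFin \o gauss c s K) x =
    (Q true true + Q true false + (Q false true + Q false false))%E.
  rewrite -!EE -(congr1 (@^~ x) (coord_intsD _ (mp1 _ (measurable_halfspace a true))
     (mp1 _ (measurable_halfspace a false)))).
  congr (coord_ints _ _ x); apply/funext => y; rewrite /p1 -EFinD; congr EFin.
  by rewrite -mulrDl indic_halfspace_split mul1r.
have nT y := gauss_marginal_bounds y sK pK c0 s0 (enum_uniq (~: C)).
have Qfin v e : Q v e \is a fin_num.
  by rewrite -QE; apply: cond_num_fin.
have dep : (Q true true * Q false false != Q true false * Q false true)%E.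
  apply: quadrants_dependent.
  - rewrite (_ : w = fun v => gauss c1 s1 K' (upd_coord (upd_coord x b 0) a v)).
      exact: (measurableT_comp (measurable_gauss c1 s1 K') (measurable_upd _ a)).
    by apply/funext => v; rewrite /w updC.
  - exact: (measurableT_comp (measurable_gauss _ s1 K') (measurable_upd _ b)).
  - by move=> v; exact: gauss_gt0.
  - by move=> v; apply: gauss_gt0; exact: expR_gt0.
  - by rewrite /theta oppr_eq0 !mulf_neq0// lt0r_neq0.
  - move=> v e; have := Qfin v e; rewrite /Q ge0_fin_numE//.
    by rewrite -/Q -QE; case/andP: (cond_num_le mgK gK0 C x (mH v e)).
apply: contra_neq dep; rewrite /cond QE EE FE TE.
move: (Qfin true true) (Qfin true false) (Qfin false true) (Qfin false false).
have := fnT_gt0 nT x; rewrite TE.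
case: (Q true true) (Q true false) (Q false true) (Q false false) =>
  [q1| |] [q2| |] [q3| |] [q4| |] //= S0 _ _ _ _ H.
rewrite -!EFinM; congr EFin.
have {}H : q1 * (q1 + q2 + (q3 + q4)) = (q1 + q2) * (q1 + q3).
  have S1 := lt0r_neq0 S0.
  move: H; rewrite mulf_div => /eqP; rewrite eqr_div ?mulf_neq0// mulrA.
  by move=> /eqP/(mulIf S1).
by lra.
Qed.

End Dependence.

(** * A criterion for perfectness *)

Section Faithful.
Variable R : realType.

Definition avoiding d (G : {set {set 'I_d}}) (C : {set 'I_d}) : rel 'I_d :=
  [rel i j | [&& i \notin C, j \notin C & adj G i j]].

Lemma avoiding_path d (G : {set {set 'I_d}}) (C : {set 'I_d}) x p :
  path (avoiding G C) x p -> path (adj G) x p /\ forall z, z \in p -> z \notin C.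
Proof.
elim: p x => [//|y p IH] x /= /andP[/and3P[_ yC xy] /IH[pp pC]]; split.
  by rewrite xy.
by move=> z; rewrite inE => /orP[/eqP->|/pC].
Qed.

Lemma path_avoiding d (G : {set {set 'I_d}}) (C : {set 'I_d}) x p :
  path (adj G) x p -> (forall z, z \in x :: p -> z \notin C) -> path (avoiding G C) x p.
Proof.
elim: p x => [//|y p IH] x /= /andP[xy pp] C0; apply/andP; split.
  by apply/and3P; split => //; apply: C0; rewrite !inE eqxx ?orbT.
by apply: IH => // z zp; apply: C0; rewrite inE zp orbT.
Qed.

Lemma separates_connect d (G : {set {set 'I_d}}) (A B C : {set 'I_d}) a b :
  separates G A B C -> a \in A -> b \in B -> a \notin C ->
  ~~ connect (avoiding G C) a b.
Proof.
move=> sep aA bB aC; apply/negP => /connectP[p pp bE].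
case/shortenP: pp bE => p' pp' up' _ bE.
have [gp pC] := avoiding_path pp'.
have bB' : last a p' \in B by rewrite -bE.
have [z zp zC] := sep a p' gp up' aA bB'.
by move: zp; rewrite inE => /orP[/eqP za|/pC]; [rewrite za (negPf aC) in zC|rewrite zC].
Qed.

Lemma connect_separates d (G : {set {set 'I_d}}) (A B C : {set 'I_d}) :
  (forall a b, a \in A -> b \in B -> ~~ connect (avoiding G C) a b) ->
  separates G A B C.
Proof.
move=> nc x p pp _ xA pB; apply: contrapT => nz.
have /negP := nc _ _ xA pB; apply; apply/connectP; exists p => //.
apply: path_avoiding => // z zp; apply/negP => zC; apply: nz; by exists z.
Qed.

Lemma qf_mx d (K : 'M[R]_d) x :
  ((\col_j tnth x j)^T *m K *m (\col_j tnth x j)) 0 0 = qf K x.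
Proof.
rewrite mxE /qf exchange_big/=; apply: eq_bigr => j _.
rewrite !mxE mulr_suml; apply: eq_bigr => k _.
by rewrite !mxE [tnth x k * _]mulrC.
Qed.

Lemma posdefmx_pd d (K : 'M[R]_d) : posdefmx K -> symmx K /\ pd_on finset.setT K.
Proof.
move=> [KT Kpos]; split; first by move=> i j; rewrite -[in LHS]KT mxE.
move=> x _ [i xi]; have := Kpos (\col_j tnth x j).
rewrite qf_mx; apply; apply/eqP => /matrixP/(_ i 0); rewrite !mxE => xi0.
by rewrite xi0 eqxx in xi.
Qed.

Lemma gaussian_pdfE d (K : 'M[R]_d) x :
  gaussian_pdf (invmx K) x =
  gauss (Num.sqrt ((2 * pi) ^+ d * \det (invmx K)))^-1 2^-1 K x.
Proof. by rewrite /gaussian_pdf invmxK qf_mx. Qed.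

(** Separation gives the Markov property by [cond_mul]. Conversely conditional
    independence, tested on two half-spaces, is by uniqueness of conditional
    probabilities an identity between ratios of integrals at almost every point,
    and [gauss_halfspaces_dependent] excludes it at every point. *)
Lemma perfect_criterion d (G : {set {set 'I_d}}) (K : 'M[R]_d) :
  posdefmx K ->
  (forall i j, i != j -> ~~ adj G i j -> K i j = 0) ->
  (forall (C : {set 'I_d}) a b, a != b -> a \notin C -> b \notin C ->
     connect (avoiding G C) a b -> pivots (enum (~: C :\ a :\ b)%SET) K a b != 0) ->
  perfect (invmx K) G.
Proof.
move=> Kpd KG Kgen dO Omega P X gX A B C dAB dAC dBC A0 B0.
have [sK pK] := posdefmx_pd Kpd.
set c := (Num.sqrt ((2 * pi) ^+ d * \det (invmx K)))^-1.
pose s : R := 2^-1.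
have s0 : 0 < s by rewrite invr_gt0.
have Xp U : measurable U ->
    distribution P X U = (\int[lebesgue_tuple R d]_(x in U) (gauss c s K x)%:E)%E.
  by move=> mU; rewrite gX//; apply: eq_integral => x _; rewrite gaussian_pdfE.
(* The constant is an inverse square root, hence nonnegative; it cannot vanish
   because the density has total mass 1. *)
have c0 : 0 < c.
  rewrite lt0r invr_ge0 sqrtr_ge0 andbT; apply/eqP => cE.
  have := Xp _ measurableT; rewrite integral0_eq; last first.
    by move=> x _; rewrite /gauss cE mul0r.
  by rewrite probability_setT => /eqP; rewrite onee_eq0.
have mgK := measurable_gauss c s K.
have gK0 y : 0 <= gauss c s K y by exact: ltW (gauss_gt0 _ _ _ c0).
have nT y := gauss_marginal_bounds y sK pK c0 s0 (enum_uniq (~: C)).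
have CP E mE := is_cond_prob_cond mgK gK0 Xp nT (E := E) mE.
split=> [sep U V mU mV|ci].
  (* A' is the part of the complement of C reachable from A. *)
  pose A' := [set i in ~: C | [exists a in A, connect (avoiding G C) a i]]%SET.
  pose B' := (~: C :\: A')%SET.
  pose E := subtup A @^-1` U; pose F := subtup B @^-1` V.
  have mE : measurable E by rewrite -[E]setTI; exact: (measurable_subtup (S := A)).
  have mF : measurable F by rewrite -[F]setTI; exact: (measurable_subtup (S := B)).
  exists (cond (gauss c s K) C E \o X), (cond (gauss c s K) C F \o X).
  split; [exact: CP|exact: CP|].
  rewrite (_ : _ \* _ = cond (gauss c s K) C (E `&` F) \o X).
    by apply: (CP (E `&` F)); exact: measurableI.
  apply/funext => w /=; apply/esym.
  have AA' i : i \in A -> i \in A'.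
    move=> iA; rewrite !inE (disjointFr dAC iA)/=; apply/existsP; exists i.
    by rewrite iA connect0.
  have BB' i : i \in B -> i \notin A'.
    move=> iB; rewrite !inE negb_and; apply/orP; right.
    apply/existsPn => a; rewrite negb_and -implybE; apply/implyP => aA.
    by apply: (separates_connect sep) => //; rewrite (disjointFr dAC aA).
  apply: (cond_mul (A' := A') (B' := B')) => //.
  - by apply/setP => i; rewrite /B' !inE; case: (i \in C) => //=; rewrite andbT orbN.
  - apply/pred0P => i /=; rewrite finset.in_setD; by case: (i \in A').
  - move=> i j; rewrite /B' !inE => /andP[iC /existsP[a /andP[aA ai]]] /andP[jA' jC].
    suff nij : ~~ adj G i j.
      have ij : i != j.
        apply: contraNneq jA' => <-; rewrite iC/=; apply/existsP; exists a.
        by rewrite aA.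
      by rewrite (sK j i) KG.
    apply: contraNN jA' => ij; rewrite jC/=; apply/existsP; exists a.
    rewrite aA/=; apply: connect_trans ai (connect1 _).
    by rewrite /avoiding/= iC jC.
  - apply: indic_indep => i; rewrite mem_enum finset.in_setD => /andP[+ _].
    exact: contraNN (AA' i).
  - by apply: indic_indep => i; rewrite mem_enum; exact: contraL (BB' i).
apply: connect_separates => a b aA bB; apply/negP => cab.
have aC : a \notin C by rewrite (disjointFr dAC aA).
have bC : b \notin C by rewrite (disjointFr dBC bB).
have ab : a != b by apply/eqP => ab; move: bB; rewrite -ab (disjointFr dAB aA).
pose U := [set z : #|A|.-tuple R | 0 <= tnth z (enum_rank_in aA a)].
pose V := [set z : #|B|.-tuple R | 0 <= tnth z (enum_rank_in bB b)].
have mhalf n (k : 'I_n) : measurable [set z : n.-tuple R | 0 <= tnth z k].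
  exact: (measurable_halfspace k true).
have [f [g [cf cg cfg]]] := ci U V (mhalf _ _) (mhalf _ _).
pose E := @halfspace R d a true; pose F := @halfspace R d b true.
have EE : subvec X A @^-1` U = X @^-1` E.
  apply/seteqP; split => w; rewrite /U /E /halfspace /= tnth_mktuple enum_rankK_in//.
have FE : subvec X B @^-1` V = X @^-1` F.
  apply/seteqP; split => w; rewrite /V /F /halfspace /= tnth_mktuple enum_rankK_in//.
have mE : measurable E by exact: measurable_halfspace.
have mF : measurable F by exact: measurable_halfspace.
rewrite EE in cf cfg; rewrite FE in cg cfg.
have mZ : measurable_fun setT (subvec X C).
  exact: (measurableT_comp (measurable_subtup (S := C)) (@measurable_funP _ _ _ _ _ X)).
have mX H : measurable H -> measurable (X @^-1` H).
  by move=> mH; rewrite -[X in measurable X]setTI; exact: measurable_funP.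
have uf := cond_prob_unique mZ (mX _ mE) cf (CP E mE).
have ug := cond_prob_unique mZ (mX _ mF) cg (CP F mF).
rewrite -preimage_setI in cfg.
have mEF := measurableI _ _ mE mF.
have ufg := cond_prob_unique mZ (mX _ mEF) cfg (CP _ mEF).
have [w [[fw gw] fgw]] : exists w, (f w = cond (gauss c s K) C E (X w) /\
    g w = cond (gauss c s K) C F (X w)) /\
    f w * g w = cond (gauss c s K) C (E `&` F) (X w).
  apply: (@ae_probability_ex _ _ _ P).
  by apply: filterS2 (filterI uf ug) ufg => w; split.
have /negP := gauss_halfspaces_dependent (X w) sK pK c0 s0 ab aC bC (Kgen C a b ab aC bC cab).
by apply; rewrite -fgw fw gw.
Qed.

End Faithful.

(** * Lebesgue measure of polynomial zero sets *)

Section PolyNull.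
Variable R : realType.
Local Notation mu := (@lebesgue_measure R).

Lemma measurable_polyfun n (f : n.-tuple R -> R) : polyfun f -> measurable_fun setT f.
Proof.
elim=> [c|i|f1 f2 _ m1 _ m2|f1 f2 _ m1 _ m2].
- exact: measurable_cst.
- exact: measurable_tnth.
- exact: measurable_funD.
- exact: measurable_funM.
Qed.

Lemma measurable_zeros n (f : n.-tuple R -> R) : polyfun f ->
  measurable [set x | f x = 0].
Proof.
move=> /measurable_polyfun mf.
by have := mf measurableT [set 0] (measurable_set1 0); rewrite setTI.
Qed.

(** Fixing the first coordinate to t leaves a function of the other ones that is
    not zero, except for finitely many t: those are the zeros on the line through
    x0 in the first direction. Induction and Tonelli's theorem conclude. *)
Lemma polyfun_zeros_null n (f : n.-tuple R -> R) x0 : polyfun f -> f x0 != 0 ->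
  lebesgue_tuple R n [set x | f x = 0] = 0%E.
Proof.
elim: n f x0 => [|n IH] f x0 pf fx0.
  rewrite /= diracE memNset//= => f0.
  by move: fx0; rewrite [x0]tuple0 -[X in f X]/([tuple]) f0 eqxx.
have mZ := measurable_zeros pf.
have mI : mnneg (fun x : n.+1.-tuple R => (\1_[set x | f x = 0] x : R)%:E).
  by split; [apply/measurable_EFinP; exact: measurable_indic|move=> x; rewrite lee_fin].
pose y0 : n.-tuple R := [tuple of behead x0].
have x0E : x0 = tuple_cons (thead x0, y0) by exact: tuple_eta.
have ptail t : polyfun (fun y : n.-tuple R => f (tuple_cons (t, y))).
  apply: (@polyfun_comp _ _ _ f (fun y => tuple_cons (t, y)) pf) => i.
  case: (unliftP ord0 i) => [j|] ->.
    under eq_fun do rewrite tnthS; exact: polyfun_coord.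
  under eq_fun do rewrite tnth0; exact: polyfun_cst.
have fin0 : finite_set [set t | f (tuple_cons (t, y0)) = 0].
  apply: (@polyfun_line_finite _ _ f (fun t => tuple_cons (t, y0)) pf).
    move=> i; case: (unliftP ord0 i) => [j|] ->.
      by exists (tnth y0 j)%:P => t; rewrite tnthS hornerC.
    by exists 'X => t; rewrite tnth0 hornerX.
  by exists (thead x0); rewrite -x0E.
transitivity (\int[lebesgue_tuple R n.+1]_x (\1_[set x | f x = 0%R] x)%:E)%E.
  by rewrite integral_indic// setIT.
rewrite integral_lebesgue_cons//.
transitivity (\int[mu]_t lebesgue_tuple R n [set y | f (tuple_cons (t, y)) = 0%R])%E.
  apply: eq_integral => t _.
  rewrite -[X in lebesgue_tuple R n X]setIT -integral_indic//; last exact: measurable_zeros.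
have mu0 : mu [set t | f (tuple_cons (t, y0)) = 0] = 0%E.
  exact: countable_lebesgue_measure0 (finite_set_countable fin0).
have mF : measurable_fun setT (fun t => lebesgue_tuple R n [set y | f (tuple_cons (t, y)) = 0]).
  rewrite (_ : (fun t => _) = (fun t => \int[lebesgue_tuple R n]_y
      (\1_[set x | f x = 0%R] (tuple_cons (t, y)))%:E)%E).
    apply: (@measurable_fun_fubini_tonelli_F _ _ _ _ _ (lebesgue_tuple R n)
      (fun z : R * n.-tuple R => (\1_[set x | f x = 0] (tuple_cons z))%:E)).
      exact: (measurableT_comp mI.1 (@measurable_tuple_cons R n)).
    by move=> z; exact: mI.2.
  apply/funext => t; rewrite -[X in lebesgue_tuple R n X]setIT -integral_indic//.
  exact: measurable_zeros.
rewrite (ge0_negligible_integral _ _ _ _ mu0)//; last first.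
  exact: countable_measurable (finite_set_countable fin0).
rewrite integral0_eq// => t [_ /eqP ft0]; exact: IH (ptail t) ft0.
Qed.

End PolyNull.

(** * Hausdorff null sets *)

Section Hausdorff.
Variable R : realType.

Definition small_cover n (s : nat) (r e : R) (A : set (n.-tuple R))
    (l : seq (set (n.-tuple R))) :=
  [/\ forall x, A x -> exists k, nth set0 l k x,
      forall k (x y : n.-tuple R), nth set0 l k x -> nth set0 l k y -> Defs.edist x y <= r &
      (\sum_(V <- l) diam_pow s V <= e%:E)%E].

(** Finite covers of small total weight: unlike countable ones they are
    concatenated when taking unions. *)
Definition finitely_null n (s : nat) (A : set (n.-tuple R)) :=
  forall r e, 0 < r -> 0 < e -> exists l, small_cover s r e A l.

Lemma diam_pow_ge0 n s (V : set (n.-tuple R)) : (0 <= diam_pow s V)%E.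
Proof. by apply: ereal_sup_ubound; left. Qed.

Lemma diam_pow0 n s : diam_pow s (set0 : set (n.-tuple R)) = 0%E.
Proof.
rewrite /diam_pow (_ : [set _ | _ in _] = set0) ?setU0 ?ereal_sup1//.
by apply/seteqP; split => // x [z []].
Qed.

Lemma finitely_null_hausdorff n s (A : set (n.-tuple R)) :
  finitely_null s A -> hausdorff s A = 0%E.
Proof.
move=> nA.
have pge0 r : (0 <= hausdorff_premeasure s r A)%E.
  apply: le_ereal_inf_tmp => _ [U _ <-]; apply: nneseries_ge0 => k _ _; exact: diam_pow_ge0.
have p0 r : 0 < r -> hausdorff_premeasure s r A = 0%E.
  move=> r0; apply/eqP; rewrite eq_le pge0 andbT.
  apply/lee_addgt0Pr => e e0; rewrite add0e.
  have [l [lA lr le]] := nA r e r0 e0.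
  apply: ge_ereal_inf; exists (\sum_(0 <= k <oo) diam_pow s (nth set0 l k))%E.
    exists (nth set0 l) => //; split=> // x /lA[k lk]; exists k => //.
  apply: le_trans le.
  rewrite (nneseries_split _ (size l)); last by move=> k _; exact: diam_pow_ge0.
  rewrite add0n eseries0 ?adde0; last first.
    by move=> k lk _; rewrite nth_default// diam_pow0.
  by rewrite (big_nth set0).
apply/eqP; rewrite eq_le; apply/andP; split.
  by apply: ge_ereal_sup => _ [r r0 <-]; rewrite p0.
by apply: ereal_sup_ubound; exists 1; [exact: ltr01|exact: p0].
Qed.

Lemma finitely_nullS n s (A B : set (n.-tuple R)) : A `<=` B ->
  finitely_null s B -> finitely_null s A.
Proof.
move=> AB nB r e r0 e0; have [l [lB lr le]] := nB r e r0 e0.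
by exists l; split => // x /AB; exact: lB.
Qed.

Lemma finitely_null0 n s : finitely_null s (set0 : set (n.-tuple R)).
Proof.
move=> r e r0 e0; exists [::]; split => //.
  by move=> k x y; rewrite nth_nil.
by rewrite big_nil lee_fin ltW.
Qed.

Lemma finitely_nullU n s (A B : set (n.-tuple R)) :
  finitely_null s A -> finitely_null s B -> finitely_null s (A `|` B).
Proof.
move=> nA nB r e r0 e0; have e20 : 0 < e / 2 by rewrite divr_gt0.
have [l [lA lr le]] := nA r _ r0 e20; have [l' [lB lr' le']] := nB r _ r0 e20.
exists (l ++ l'); split.
- move=> x [/lA[k lk]|/lB[k lk]].
    exists k; rewrite nth_cat; case: ltnP => // kl.
    by move: lk; rewrite nth_default.
  by exists (size l + k)%N; rewrite nth_cat ltnNge leq_addr/= addKn.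
- by move=> k x y; rewrite nth_cat; case: ltnP => _; [exact: lr|exact: lr'].
- by rewrite big_cat/= [e]splitr EFinD leeD.
Qed.

Lemma finitely_null_bigU n s (I : finType) (A : I -> set (n.-tuple R)) :
  (forall i, finitely_null s (A i)) -> finitely_null s (\bigcup_i A i).
Proof.
move=> nA; apply: (@finitely_nullS _ _ _ (\big[setU/set0]_(i <- enum I) A i)).
  move=> x [i _ Aix]; rewrite -bigcup_seq; exists i => //=; exact: mem_enum.
elim: (enum I) => [|i r IH]; first by rewrite big_nil; exact: finitely_null0.
by rewrite big_cons; exact: finitely_nullU.
Qed.

End Hausdorff.

(** * Hausdorff measure of polynomial zero sets *)

Section Boxes.
Variable R : realType.
Local Notation mu := (@lebesgue_measure R).

Definition box n (a : n.-tuple R) (h : R) : set (n.-tuple R) :=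
  [set x | forall i, tnth a i <= tnth x i < tnth a i + h].

Lemma box_preimage_cons n (a : n.+1.-tuple R) h :
  @tuple_cons R n @^-1` (box a h) =
  `[thead a, thead a + h[%classic `*` box [tuple of behead a] h.
Proof.
apply/seteqP; split => [[t y]|[t y] []].
  move=> /= H; split => /=; first by have := H ord0; rewrite tnth0 in_itv.
  move=> i; have := H (lift ord0 i); rewrite tnthS.
  by rewrite [a in tnth a _]tuple_eta tnthS.
rewrite /= in_itv/= => Ht Hy i; case: (unliftP ord0 i) => [j|] ->.
  by rewrite tnthS [a in tnth a _]tuple_eta tnthS.
by rewrite tnth0.
Qed.

Lemma measurable_box n (a : n.-tuple R) h : measurable (box a h).
Proof.
rewrite (_ : box a h =
    \bigcap_i ((fun x : n.-tuple R => tnth x i) @^-1` `[tnth a i, tnth a i + h[%classic)).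
  apply: fin_bigcap_measurable => // i _.
  by rewrite -[X in measurable X]setTI; apply: (@measurable_tnth _ R n i).
apply/seteqP; split => x H i => [_|]; first by rewrite /= in_itv; exact: H.
by have := H i I; rewrite /= in_itv.
Qed.

Lemma lebesgue_box n (a : n.-tuple R) h : 0 <= h ->
  lebesgue_tuple R n (box a h) = (h ^+ n)%:E.
Proof.
move=> h0; elim: n a => [|n IH] a.
  by rewrite /= diracE mem_set// => -[].
transitivity ((mu \x lebesgue_tuple R n)%E (@tuple_cons R n @^-1` (box a h))) => //.
rewrite box_preimage_cons product_measure1E//; last exact: measurable_box.
have muE : mu `[thead a, thead a + h[%classic = h%:E.
  rewrite lebesgue_measure_itv/= lte_fin; case: ltP => [_|].
    by rewrite -EFinB addrAC subrr add0r.
  by rewrite gerDl => h0'; apply/eqP; rewrite eqe eq_le h0 h0'.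
by rewrite IH exprS EFinM; congr (_ * _)%E; exact: muE.
Qed.

Definition supball n (r : R) : set (n.-tuple R) := [set x | forall i, `|tnth x i| <= r].

Lemma measurable_supball n r : measurable (@supball n r).
Proof.
rewrite (_ : supball r = \bigcap_i ((fun x : n.-tuple R => tnth x i) @^-1` `[-r, r]%classic)).
  apply: fin_bigcap_measurable => // i _.
  by rewrite -[X in measurable X]setTI; apply: (@measurable_tnth _ R n i).
apply/seteqP; split => x H i => [_|]; first by rewrite /= in_itv/= -ler_norml; exact: H.
by have := H i I; rewrite /= in_itv/= -ler_norml.
Qed.

Lemma lebesgue_supball_fin n r : 0 <= r -> (lebesgue_tuple R n (supball r) < +oo)%E.
Proof.
move=> r0; pose a : n.-tuple R := [tuple - r | i < n].
have h0 : 0 <= r + r + 1 by rewrite !addr_ge0.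
apply: (@le_lt_trans _ _ (lebesgue_tuple R n (box a (r + r + 1)))).
  apply: le_measure; rewrite ?inE; [exact: measurable_supball|exact: measurable_box|].
  move=> x H i; rewrite tnth_mktuple; have := H i; rewrite ler_norml => /andP[-> xr].
  by rewrite /= addrA addKr; apply: le_lt_trans xr _; rewrite ltrDl.
by rewrite lebesgue_box// ltry.
Qed.

(** The induction carries a bound B along, as products require it. *)
Lemma polyfun_lipschitz n (f : n.-tuple R -> R) r : polyfun f ->
  exists2 L, 0 <= L & forall x y h, supball r x -> supball r y -> 0 <= h ->
    (forall i, `|tnth x i - tnth y i| <= h) -> `|f x - f y| <= L * h.
Proof.
move=> pf; suff [L [B [L0 B0 LB]]] : exists L B, [/\ 0 <= L, 0 <= B &
    forall x, supball r x -> `|f x| <= B /\ forall y h, supball r y -> 0 <= h ->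
    (forall i, `|tnth x i - tnth y i| <= h) -> `|f x - f y| <= L * h].
  by exists L => // x y h bx by_ h0 xy; exact: (LB x bx).2.
elim: pf => [c|i|f1 f2 _ [L1 [B1 [L10 B10 H1]]] _ [L2 [B2 [L20 B20 H2]]]
               |f1 f2 _ [L1 [B1 [L10 B10 H1]]] _ [L2 [B2 [L20 B20 H2]]]].
- exists 0, `|c|; split => // x _; split => // y h _ h0 _.
  by rewrite subrr normr0 mul0r.
- exists 1, `|r|; split => // x bx; split=> [|y h _ h0]; last by rewrite mul1r; apply.
  by apply: le_trans (bx i) _; exact: ler_norm.
- exists (L1 + L2), (B1 + B2); split; rewrite ?addr_ge0// => x bx.
  have [b1 l1] := H1 x bx; have [b2 l2] := H2 x bx; split.
    exact: le_trans (ler_normD _ _) (lerD b1 b2).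
  move=> y h by_ h0 xy; have := l1 y h by_ h0 xy; have := l2 y h by_ h0 xy => a b.
  rewrite opprD addrACA mulrDl.
  exact: le_trans (ler_normD _ _) (lerD b a).
- exists (L1 * B2 + B1 * L2), (B1 * B2); split; rewrite ?addr_ge0 ?mulr_ge0// => x bx.
  have [b1 l1] := H1 x bx; have [b2 l2] := H2 x bx; split.
    by rewrite normrM ler_pM.
  move=> y h by_ h0 xy; have := l1 y h by_ h0 xy; have := l2 y h by_ h0 xy => a b.
  have [b1' _] := H1 y by_.
  rewrite (_ : _ - _ = (f1 x - f1 y) * f2 x + f1 y * (f2 x - f2 y)); last by ring.
  rewrite [leRHS]mulrDl; apply: le_trans (ler_normD _ _) _; rewrite !normrM; apply: lerD.
    by rewrite -mulrA [B2 * h]mulrC mulrA ler_pM.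
  by rewrite -mulrA ler_pM.
Qed.

Lemma edist_le m (z w : m.-tuple R) h : 0 <= h ->
  (forall i, `|tnth z i - tnth w i| <= h) -> Defs.edist z w <= m%:R * h.
Proof.
move=> h0 zw; have mh0 : 0 <= m%:R * h by rewrite mulr_ge0.
rewrite /Defs.edist -[leRHS](ger0_norm mh0) -sqrtr_sqr ler_wsqrtr//.
apply: (@le_trans _ _ (\sum_(i < m) h ^+ 2)).
  apply: ler_sum => i _; rewrite -[leLHS]real_normK ?num_real//.
  by rewrite ler_pXn2r// nnegrE.
rewrite sumr_const card_ord exprMn -[h ^+ 2 *+ m]mulr_natl ler_wpM2r ?sqr_ge0//.
by rewrite -natrX ler_nat; case: m {zw mh0 z w} => // m; rewrite leq_pmull.
Qed.

Section Grid.
Variables (n : nat) (f : n.-tuple R -> R).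
Hypothesis pf : polyfun f.
Hypothesis f0 : exists x, f x != 0.

Let Z := [set x | f x = 0] `&` supball 1.

Lemma measurable_sublevel (r a : R) :
  measurable (supball r `&` [set x : n.-tuple R | `|f x| <= a]).
Proof.
apply: measurableI; first exact: measurable_supball.
have mn : measurable_fun setT (fun x => `|f x|).
  by apply: measurableT_comp => //; exact: measurable_polyfun.
have := mn measurableT `]-oo, a]%classic (measurable_itv _).
by rewrite setTI; congr measurable; apply/seteqP; split => x /=; rewrite in_itv.
Qed.

(** As N grows these sets decrease to a subset of the null zero set. *)
Lemma near_zeros_small (L e : R) : 0 <= L -> 0 < e ->
  exists N0, forall N, (N0 <= N)%N ->
  (lebesgue_tuple R n (supball 2 `&` [set x | (`|f x| <= L * N.+1%:R^-1)%R]) <= e%:E)%E.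
Proof.
move=> L0 e0; pose S N := supball 2 `&` [set x | `|f x| <= L * N.+1%:R^-1].
have mS N : measurable (S N) by exact: measurable_sublevel.
have SZ : \bigcap_N S N `<=` [set x | f x = 0].
  move=> x Sx; apply/eqP; rewrite -normr_le0; apply/ler_addgt0Pr => d d0; rewrite add0r.
  pose N := Num.truncn (L / d); have [_ fN] := Sx N I.
  apply: le_trans fN _; rewrite ler_pdivrMr// mulrC -ler_pdivrMr//.
  by have /andP[_ /ltW] := truncn_itv (divr_ge0 L0 (ltW d0)).
have S0 : lebesgue_tuple R n (\bigcap_N S N) = 0%E.
  have [x0 fx0] := f0.
  apply/eqP; rewrite -measure_le0 -(polyfun_zeros_null pf fx0).
  apply: le_measure; rewrite ?inE//; last exact: measurable_zeros.
  exact: bigcapT_measurable.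
have nS : nonincreasing_seq S.
  move=> i j ij; apply/subsetPset => x [bx /= fx]; split => //=.
  by apply: le_trans fx _; rewrite ler_wpM2l// lef_pV2 ?posrE// ler_nat.
have Soo : (lebesgue_tuple R n (S 0%N) < +oo)%E.
  apply: le_lt_trans (lebesgue_supball_fin n (ler0n R 2)).
  by apply: le_measure; rewrite ?inE//; [exact: measurable_supball|exact: subIsetl].
have cv : (lebesgue_tuple R n \o S) @ \oo --> 0%E.
  by rewrite -S0; apply: nonincreasing_cvg_mu => //; exact: bigcapT_measurable.
have [N0 HN0] : exists N0, (lebesgue_tuple R n (S N0) <= e%:E)%E.
  apply: contrapT => nN.
  have : (e%:E <= limn (lebesgue_tuple R n \o S))%E.
    apply: lime_ge; first by apply/cvg_ex; exists 0%E.
    by apply: nearW => N; rewrite leNgt; apply/negP => /ltW H; apply: nN; exists N.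
  by rewrite (cvg_lim _ cv)// lee_fin leNgt e0.
exists N0 => N N0N; apply: le_trans HN0; apply: le_measure; rewrite ?inE//.
  exact: (mS N).
exact/subsetPset/nS.
Qed.

(* Cubes of side 1 / (N + 1) from -1 on; those of the last index reach beyond 1
   and contain the points with a coordinate equal to 1. *)
Let cube (N : nat) (k : n.-tuple 'I_(2 * N.+1).+1) : set (n.-tuple R) :=
  box [tuple -1 + (tnth k i)%:R * N.+1%:R^-1 | i < n] N.+1%:R^-1.

Lemma cube_triv N (D : set (n.-tuple 'I_(2 * N.+1).+1)) : trivIset D (@cube N).
Proof.
have h0 : 0 < (N.+1%:R : R)^-1 by rewrite invr_gt0.
move=> k l _ _ [x [xk xl]]; apply: eq_from_tnth => i; apply: val_inj => /=.
have aux (a b : nat) : -1 + a%:R * N.+1%:R^-1 <= tnth x i ->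
    tnth x i < -1 + b%:R * N.+1%:R^-1 + N.+1%:R^-1 -> (a <= b)%N.
  move=> ax xb; have := le_lt_trans ax xb.
  by rewrite -addrA ltrD2l -[X in _ < _ + X]mul1r -mulrDl ltr_pM2r// natr1 ltr_nat ltnS.
have := xk i; have := xl i; rewrite !tnth_mktuple => /andP[l1 l2] /andP[k1 k2].
by apply/eqP; rewrite eqn_leq (aux _ _ k1 l2) (aux _ _ l1 k2).
Qed.

Lemma cube_cover N x : supball 1 x -> exists k, @cube N k x.
Proof.
move=> bx; have N0 : 0 < (N.+1%:R : R) by rewrite ltr0n.
pose q i := Num.truncn ((tnth x i + 1) * N.+1%:R).
have x1 i : 0 <= tnth x i + 1 <= 2.
  have := bx i; rewrite ler_norml => /andP[a b].
  by rewrite -lerBlDr sub0r a -lerBrDr (le_trans b)//; lra.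
have qP i : (q i < (2 * N.+1).+1)%N.
  rewrite ltnS -(ler_nat R); have /andP[a b] := x1 i.
  have y0 : 0 <= (tnth x i + 1) * N.+1%:R by rewrite mulr_ge0.
  have /andP[qy _] := truncn_itv y0; apply: le_trans qy _.
  by rewrite natrM ler_wpM2r.
exists [tuple Ordinal (qP i) | i < n] => i; rewrite !tnth_mktuple/=.
have /andP[a b] := x1 i.
have y0 : 0 <= (tnth x i + 1) * N.+1%:R by rewrite mulr_ge0.
have /andP[qy yq] := truncn_itv y0; rewrite -/(q i) in qy yq.
apply/andP; split.
  by rewrite -lerBrDl opprK ler_pdivrMr.
by rewrite -addrA -ltrBlDl opprK -[X in _ < _ + X]mul1r -mulrDl natr1 ltr_pdivlMr.
Qed.

(** The grid cubes that meet the zero set lie where |f| <= L h, h being the mesh.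
    By [near_zeros_small] their total volume tends to 0 with h, and phi maps a
    cube, of volume h ^ n, to a set of diameter at most m h. The argument needs
    the zero set to be closed, which is used in the form of the Lipschitz
    bound. *)
Lemma zeros_finitely_null m (phi : n.-tuple R -> m.-tuple R) :
  (forall x y h, (forall i, `|tnth x i - tnth y i| <= h) -> 0 <= h ->
     forall j, `|tnth (phi x) j - tnth (phi y) j| <= h) ->
  finitely_null n (phi @` Z).
Proof.
move=> phiL r e r0 e0.
have [L L0 fL] := polyfun_lipschitz 2 pf.
(* (m h) ^ n bounds the weight of the image of a cube of volume h ^ n; the
   summand 1 keeps C positive when m = 0. *)
pose C : R := (m%:R) ^+ n + 1.
have C0 : 0 < C by rewrite ltr_wpDl// exprn_ge0.
have [N0 HN0] := near_zeros_small L0 (divr_gt0 e0 C0).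
pose N := maxn N0 (Num.truncn (m%:R / r)).
pose h : R := N.+1%:R^-1.
have h0 : 0 < h by rewrite invr_gt0.
have mhr : m%:R * h <= r.
  rewrite ler_pdivrMr// mulrC -ler_pdivrMr//.
  have /andP[_ /ltW H] := truncn_itv (divr_ge0 (ler0n R m) (ltW r0)).
  by apply: le_trans H _; rewrite ler_nat ltnS leq_maxr.
pose D := [set k : n.-tuple 'I_(2 * N.+1).+1 | exists x, Z x /\ cube k x].
pose ks := [seq k <- enum {: n.-tuple 'I_(2 * N.+1).+1} | `[< D k >]].
have uks : uniq ks by rewrite filter_uniq// enum_uniq.
have ksP k : (k \in ks) = `[< D k >] by rewrite mem_filter mem_enum andbT.
pose V (k : n.-tuple 'I_(2 * N.+1).+1) := phi @` (Z `&` cube k).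
have near_cube k x y : @cube N k x -> @cube N k y -> forall i, `|tnth x i - tnth y i| <= h.
  move=> kx ky i; have := kx i; have := ky i; rewrite !tnth_mktuple -/h => /andP[a b] /andP[c d].
  by rewrite ler_norml; apply/andP; split; lra.
have Vclose k z w : V k z -> V k w -> Defs.edist z w <= m%:R * h.
  move=> [x [_ kx] <-] [y [_ ky] <-]; apply: edist_le; first exact: ltW.
  by apply: phiL; [exact: near_cube kx ky|exact: ltW].
exists [seq V k | k <- ks]; split.
- move=> _ [x Zx <-]; have [k kx] := cube_cover N Zx.2.
  have kD : k \in ks by rewrite ksP; apply/asboolP; exists x.
  exists (index k ks); rewrite (nth_map k) ?index_mem// nth_index//.
  by exists x.
- move=> j z w; case: (ltnP j (size ks)) => [jl|jl]; last first.
    by rewrite nth_default// size_map.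
  have k0 : n.-tuple 'I_(2 * N.+1).+1 by exact: [tuple ord0 | i < n].
  rewrite (nth_map k0)// => zk wk.
  exact: le_trans (Vclose _ _ _ zk wk) mhr.
rewrite big_map.
apply: (@le_trans _ _ (\sum_(k <- ks) ((m%:R ^+ n)%:E * lebesgue_tuple R n (@cube N k)))%E).
  apply: lee_sum => k _; rewrite /cube (lebesgue_box _ (ltW h0)) -EFinM -exprMn.
  apply: ge_ereal_sup => _ [->|[[z w] [/= zk wk] <-]].
    by rewrite lee_fin exprn_ge0// mulr_ge0// ltW.
  rewrite lee_fin lerXn2r ?nnegrE ?sqrtr_ge0 ?mulr_ge0 ?(ltW h0)//.
  exact: Vclose zk wk.
rewrite -ge0_sume_distrr; last by move=> k _; exact: measure_ge0.
have -> : (\sum_(k <- ks) lebesgue_tuple R n (@cube N k) =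
    lebesgue_tuple R n (\bigcup_(k in [set` ks]) @cube N k))%E.
  rewrite measure_fin_bigcup//; last 2 first.
    exact: cube_triv.
    by move=> k _; exact: measurable_box.
  by rewrite fsbig_seq.
have Ule : (lebesgue_tuple R n (\bigcup_(k in [set` ks]) @cube N k) <= (e / C)%:E)%E.
  apply: le_trans (HN0 N (leq_maxl _ _)).
  apply: le_measure; rewrite ?inE.
  - by apply: fin_bigcup_measurable => // k _; exact: measurable_box.
  - exact: measurable_sublevel.
  - move=> y [k /= + ky]; rewrite ksP => /asboolP[x [[/= fx bx] kx]].
    have xy := near_cube _ _ _ ky kx.
    have b2 : supball 2 y.
      move=> i; rewrite -[tnth y i](subrK (tnth x i)) (le_trans (ler_normD _ _))//.
      rewrite [leRHS](_ : _ = 1 + 1); last by rewrite -natr1.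
      by rewrite lerD ?bx// (le_trans (xy i))// invf_le1// ler1n.
    split => //=; rewrite -[f y]subr0 -fx; apply: (fL _ _ _ b2 _ (ltW h0) xy).
    by move=> i; apply: le_trans (bx i) _; rewrite ler1n.
apply: (@le_trans _ _ ((m%:R ^+ n)%:E * (e / C)%:E)%E).
  by apply: lee_wpmul2l => //; rewrite lee_fin exprn_ge0.
rewrite -EFinM lee_fin mulrA ler_pdivrMr// mulrC ler_pM2l//.
by rewrite /C lerDl ler01.
Qed.

End Grid.

Definition insert_coord n (k : 'I_n) (s : R) (x : n.-1.-tuple R) : n.-tuple R :=
  [tuple if unlift k i is Some j then tnth x j else s | i < n].

(** On a hyperplane z_k = s, parametrized by [insert_coord], f is a polynomial
    function of the other coordinates. *)
Lemma face_zeros_null n (f : n.-tuple R -> R) (k : 'I_n) (s : R) : polyfun f ->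
  (exists2 z, tnth z k = s & f z != 0) ->
  finitely_null n.-1 [set z | [/\ tnth z k = s, supball 1 z & f z = 0]].
Proof.
move=> pf [z0 z0k fz0]; pose del (z : n.-tuple R) := [tuple tnth z (lift k j) | j < n.-1].
have insK z : tnth z k = s -> insert_coord k s (del z) = z.
  move=> zk; apply: eq_from_tnth => i; rewrite tnth_mktuple.
  by case: unliftP => [j|] -> //; rewrite tnth_mktuple.
have pg : polyfun (fun x => f (insert_coord k s x)).
  apply: (polyfun_comp pf) => i; under eq_fun do rewrite tnth_mktuple.
  by case: unliftP => [j|] _; [exact: polyfun_coord|exact: polyfun_cst].
have g0 : exists x, f (insert_coord k s x) != 0 by exists (del z0); rewrite insK.
apply: (finitely_nullS _ (@zeros_finitely_null _ _ pg g0 _ (insert_coord k s) _)).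
  move=> z [zk bz fz]; exists (del z); last exact: insK.
  by split; [rewrite /= insK|move=> j; rewrite tnth_mktuple; exact: bz].
move=> x y h xy h0 j; rewrite !tnth_mktuple; case: unliftP => [i|] _ //.
by rewrite subrr normr0.
Qed.

End Boxes.

(** * The polynomial of a graph *)

Section Generic.
Variables (R : realType) (d : nat) (G : {set {set 'I_d}}).
Hypothesis hG : simple_graph G.
Local Notation g := #|G|.

Definition scale_tuple n (e : R) (y : n.-tuple R) : n.-tuple R := [tuple e * tnth y k | k < n].

Lemma Amx_scale (dl : g.-tuple R) e : Amx dl e = Amx (scale_tuple e dl) 1.
Proof.
apply/matrixP => i j; rewrite !mxE; case: eqP => // _; case: pickP => // k _.
by rewrite tnth_mktuple mulr1 mulrC.
Qed.

Lemma Amx_symm (dl : g.-tuple R) e : symmx (Amx dl e).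
Proof.
by move=> i j; rewrite !mxE eq_sym; case: eqP => // _; rewrite (finset.setUC [set i]%SET).
Qed.

Lemma Amx_diag (dl : g.-tuple R) e i : Amx dl e i i = 1.
Proof. by rewrite mxE eqxx. Qed.

Lemma Amx_edge (dl : g.-tuple R) e i j k : enum_val k = [set i; j]%SET ->
  i != j /\ Amx dl e i j = tnth dl k * e.
Proof.
move=> kE; have ij : i != j.
  have := hG (enum_valP k); rewrite kE cards2; by case: (i != j).
split=> //; rewrite mxE (negPf ij); case: pickP => [k' /eqP k'E|/(_ k)].
  by congr (tnth _ _ * _); apply: enum_val_inj; rewrite k'E kE.
by rewrite kE eqxx.
Qed.

Lemma Amx_nonedge (dl : g.-tuple R) e i j : i != j -> ~~ adj G i j -> Amx dl e i j = 0.
Proof.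
move=> ij nij; rewrite mxE (negPf ij); case: pickP => // k /eqP kE.
by move: nij; rewrite /adj/= -kE enum_valP.
Qed.

Lemma adj_edge i j : adj G i j -> exists k : 'I_g, enum_val k = [set i; j]%SET.
Proof.
move=> ij; have ijG : [set i; j]%SET \in G := ij.
by exists (enum_rank_in ijG [set i; j]%SET); rewrite enum_rankK_in.
Qed.

Definition connected_triple (t : {set 'I_d} * 'I_d * 'I_d) : bool :=
  let: (C, a, b) := t in
  [&& a != b, a \notin C, b \notin C & connect (avoiding G C) a b].

(** A product, so that one polynomial that is not zero handles all triples. *)
Definition faithful_poly (y : g.-tuple R) : R :=
  \prod_(t | connected_triple t)
    pivots (enum (~: t.1.1 :\ t.1.2 :\ t.2)%SET) (Amx y 1) t.1.2 t.2.

Lemma polyfun_faithful : polyfun faithful_poly.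
Proof.
apply: polyfun_prod => t _; apply: polyfun_pivots => i j.
under eq_fun do rewrite mxE; case: eqP => _; first exact: polyfun_cst.
case: pickP => [k _|_]; last exact: polyfun_cst.
by apply: polyfunM; [exact: polyfun_coord|exact: polyfun_cst].
Qed.

(** Negative, to make the off-diagonal entries of Amx nonpositive, and small
    enough for diagonal dominance. *)
Definition small_weight : R := - d.+1%:R^-1.

Lemma pd_on_sub (T T' : {set 'I_d}) (M : 'M[R]_d) : T' \subset T -> pd_on T M -> pd_on T' M.
Proof.
move=> /fintype.subsetP TT pM x x0; apply: pM => i iT; apply: x0.
exact: contraNN (TT i) iT.
Qed.

(** Bounding 2 |x_i x_j| by x_i ^ 2 + x_j ^ 2 in every off-diagonal term leaves
    at least (1 - d / (d + 1)) S, where S is the sum of the squares. *)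
Lemma Amx_small_weight_pd : pd_on finset.setT (Amx [tuple small_weight | _ < g] 1).
Proof.
set M := Amx _ _; move=> x _ [i0 xi0].
pose t : R := d.+1%:R^-1; pose S := \sum_i tnth x i ^+ 2.
have t0 : 0 < t by rewrite invr_gt0.
have S0 : 0 < S.
  rewrite /S (bigD1 i0)//= ltr_pwDl ?exprn_even_gt0//.
  by apply: sumr_ge0 => j _; exact: sqr_ge0.
have ME i j : M i j * tnth x i * tnth x j >=
    (if i == j then tnth x i ^+ 2 else 0) - t / 2 * (tnth x i ^+ 2 + tnth x j ^+ 2).
  rewrite /M mxE; case: (eqVneq i j) => [->|ij].
    rewrite mul1r -expr2 gerBl mulr_ge0// ?addr_ge0 ?sqr_ge0//.
    by rewrite divr_ge0// ltW.
  case: pickP => [k _|_].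
    rewrite tnth_mktuple mulr1 /small_weight -/t sub0r.
    have -> : - t * tnth x i * tnth x j = - (t / 2 * (2 * tnth x i * tnth x j)) by field.
    rewrite lerN2 ler_wpM2l//; first by rewrite divr_ge0// ltW.
    have -> : 2 * tnth x i * tnth x j =
        tnth x i ^+ 2 + tnth x j ^+ 2 - (tnth x i - tnth x j) ^+ 2 by ring.
    by rewrite gerBl sqr_ge0.
  rewrite !mul0r sub0r oppr_le0 mulr_ge0// ?addr_ge0 ?sqr_ge0//.
  by rewrite divr_ge0// ltW.
apply: (@lt_le_trans _ _ (\sum_i \sum_j ((if i == j then tnth x i ^+ 2 else 0)
   - t / 2 * (tnth x i ^+ 2 + tnth x j ^+ 2)))); last first.
  by apply: ler_sum => i _; apply: ler_sum => j _; exact: ME.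
have -> : \sum_i \sum_j ((if i == j then tnth x i ^+ 2 else 0)
   - t / 2 * (tnth x i ^+ 2 + tnth x j ^+ 2)) = S - t * d%:R * S.
  transitivity (\sum_i (tnth x i ^+ 2 - t / 2 * (d%:R * tnth x i ^+ 2 + S))).
    apply: eq_bigr => i _; rewrite big_split/= -big_mkcond/= (big_pred1 i); last first.
      by move=> j; rewrite /= eq_sym.
    congr (_ + _).
    rewrite sumrN; congr (- _); rewrite -mulr_sumr big_split/=; congr (_ * (_ + _)).
    by rewrite sumr_const card_ord mulr_natl.
  rewrite sumrB -mulr_sumr big_split/= -mulr_sumr -/S sumr_const card_ord -mulr_natl.
  by field.
rewrite (_ : S - _ = S * t) ?mulr_gt0//.
rewrite /t; field; by [].
Qed.

(** With equal small negative weights, every factor is negative. *)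
Lemma faithful_poly_neq0 : faithful_poly [tuple small_weight | _ < g] != 0.
Proof.
apply/prodf_neq0 => -[[C a] b] /and4P[ab aC bC cab] /=.
set M := Amx _ _; have sM : symmx M by exact: Amx_symm.
have weight_lt0 : small_weight < 0 by rewrite oppr_lt0 invr_gt0.
have nM : offdiag_npos M.
  move=> i j ij; rewrite /M mxE (negPf ij); case: pickP => // k _.
  by rewrite tnth_mktuple mulr1 ltW.
rewrite lt_eqF//; apply: (@pivots_neg _ _ _ (~: C)) => //.
- by apply: pd_on_sub Amx_small_weight_pd; exact: finset.subsetT.
- exact: enum_uniq.
- by move=> i; rewrite mem_enum !inE => /and3P[].
- by rewrite mem_enum !inE eqxx andbF.
- by rewrite mem_enum !inE eqxx.
- move=> i; rewrite mem_enum !inE => iC; rewrite iC andbT negb_and !negbK.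
  by move=> /orP[/eqP|/eqP]; [right|left].
- apply: connect_sub cab => i j /and3P[iC jC /adj_edge[k kE]]; apply: connect1.
  have [ij ME] := Amx_edge [tuple small_weight | _ < g] 1 kE.
  by rewrite /neg_rel/= !inE iC jC ij/= /M ME tnth_mktuple mulr1.
Qed.

(** For some e' > e the matrix Amx dl e' is positive definite, and Amx dl e is
    a convex combination of it and the identity. *)
Lemma MG_posdef (dl : g.-tuple R) e : MG R G (dl, e) -> posdefmx (Amx dl e).
Proof.
move=> [/= _ e0]; rewrite /eps_max => /ereal_sup_gt[_ [e' [e'0 [_ pd']] <-]].
rewrite lte_fin => ee'.
split; first by apply/matrixP => i j; rewrite mxE Amx_symm.
move=> x x0; pose r := e / e'.
have r01 : 0 < r < 1 by rewrite divr_gt0//= ltr_pdivrMr// mul1r.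
have -> : Amx dl e = (1 - r)%:M + r *: Amx dl e'.
  apply/matrixP => i j; rewrite !mxE; case: (eqVneq i j) => [_|_].
    by rewrite mulr1 mulr1n subrK.
  rewrite mulr0n add0r; case: pickP => [k _|_]; last by rewrite mulr0.
  by rewrite /r; field; exact: lt0r_neq0.
rewrite mulmxDr mulmxDl mul_mx_scalar -scalemxAr -!scalemxAl mxE.
have xx : 0 <= (x^T *m x) 0 0.
  by rewrite mxE; apply: sumr_ge0 => i _; rewrite mxE -expr2 sqr_ge0.
have := pd' x x0; case/andP: r01 => r0 r1 px.
rewrite [X in X + _]mxE [X in _ + X]mxE ltr_wpDl//.
  by rewrite mulr_ge0// subr_ge0 ltW.
by rewrite mulr_gt0.
Qed.

Lemma MG_perfect (dl : g.-tuple R) e : MG R G (dl, e) -> faithful_poly (scale_tuple e dl) != 0 ->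
  perfect (invmx (Amx dl e)) G.
Proof.
move=> /MG_posdef pdA /prodf_neq0 F0; apply: perfect_criterion => //.
  exact: Amx_nonedge.
move=> C a b ab aC bC cab; rewrite Amx_scale.
by apply: (F0 (C, a, b)); apply/and4P.
Qed.

Lemma NG_zero (dl : g.-tuple R) e : NG R G (dl, e) -> faithful_poly (scale_tuple e dl) = 0.
Proof.
move=> [M np]; apply/eqP; apply: contrapT => /negP F0; apply: np.
exact: MG_perfect.
Qed.

(** The principal minor of an edge of weight delta is 1 - (delta e) ^ 2. *)
Lemma MG_eps_lt1 (dl : g.-tuple R) e k : MG R G (dl, e) -> `|tnth dl k| = 1 -> 0 < e < 1.
Proof.
move=> M dk; have [_ /= e0 _] := M; rewrite e0/=.
have [i [j [ij kE]]] : exists i j, i != j /\ enum_val k = [set i; j]%SET.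
  by have /eqP/cards2P[i [j [ij kE]]] := hG (enum_valP k); exists i, j.
have [_ AE] := Amx_edge dl e kE.
have [sA pA] := posdefmx_pd (MG_posdef M).
have jT : j \in (finset.setT :\ i)%SET by rewrite !inE eq_sym ij.
have := pd_on_diag (pd_on_pivot sA pA (finset.in_setT i)) jT.
rewrite mxE !Amx_diag (sA j i) AE mulr1 subr_gt0 => H.
have : e ^+ 2 < 1.
  by move: H; rewrite -expr2 exprMn -[X in X * _]real_normK ?num_real// dk expr1n mul1r.
by rewrite expr_lt1// ltW.
Qed.

Lemma sphere_coord (dl : g.-tuple R) : cube_star R G dl -> sphere_inf R G dl ->
  exists k (b : bool), tnth dl k = (-1) ^+ b.
Proof.
move=> cdl sdl; have [k dk] : exists k, `|tnth dl k| = 1.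
  apply: contrapT => nk; suff : \big[Num.max/0]_(k < g) `|tnth dl k| < 1 by rewrite sdl ltxx.
  apply: bigmax_lt => // k _; rewrite lt_neqAle; apply/andP; split.
    by apply/eqP => dk; apply: nk; exists k.
  by rewrite ler_norml; case: (cdl k).
exists k; move: dk; case: (ger0P (tnth dl k)) => _ dk; first by exists false.
by exists true; rewrite expr1 -dk opprK.
Qed.

Lemma cube_star_norm (dl : g.-tuple R) k : cube_star R G dl -> `|tnth dl k| <= 1.
Proof. by move=> /(_ k)[+ _]; rewrite ler_norml. Qed.

(** This scaling moves the point with all coordinates (-1) ^ b, which lies on a
    face of the cube, to the one where faithful_poly is known not to vanish. *)
Definition face_scale (b : bool) : R := (-1) ^+ b * small_weight.

Lemma face_scaleK (b : bool) : face_scale b * (-1) ^+ b = small_weight.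
Proof. by rewrite /face_scale mulrC mulrA -expr2 sqrr_sign mul1r. Qed.

(** The condition faithful_poly (eps * delta) = 0 of [NG_zero] as a polynomial
    equation in the point (eps, delta). *)
Definition cone_poly (z : g.+1.-tuple R) : R :=
  faithful_poly (scale_tuple (thead z) [tuple of behead z]).

Lemma cone_polyE e dl : cone_poly (tuple_cons (e, dl)) = faithful_poly (scale_tuple e dl).
Proof.
rewrite /cone_poly; congr (faithful_poly (scale_tuple _ _)).
by apply: val_inj.
Qed.

Lemma polyfun_cone : polyfun cone_poly.
Proof.
apply: (polyfun_comp polyfun_faithful) => i; under eq_fun do rewrite tnth_mktuple.
apply: polyfunM; first exact: polyfun_coord.
under eq_fun do rewrite tnth_behead.
exact: polyfun_coord.
Qed.

End Generic.

(** * Null sets of edge weights *)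

Lemma finitely_null_face_union (R : realType) n (s : nat)
    (A : set (n.-tuple R)) (B : 'I_n -> bool -> set (n.-tuple R)) :
  (forall k b, finitely_null s (B k b)) ->
  (forall x, A x -> exists k b, B k b x) -> finitely_null s A.
Proof.
move=> nB AB; apply: (finitely_nullS _ (finitely_null_bigU
  (A := fun kb : 'I_n * bool => B kb.1 kb.2) _)).
  by move=> x /AB[k [b Bx]]; exists (k, b).
by move=> -[k b].
Qed.

Theorem theorem2 (R : realType) (d : nat) (G : {set {set 'I_d}})
    (hG : simple_graph G) (hg : (2 <= #|G|)%N) :
  (exists D : set (#|G|.-tuple R),
    [/\ D `<=` cube_star R G,
        (lebesgue_tuple R #|G|).-negligible (cube_star R G `\` D),
        hausdorff #|G|.-1 (sphere_inf R G `&` (cube_star R G `\` D)) = 0%E &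
        forall dl, D dl -> finite_set (BG dl)]) /\
  [/\ (lebesgue_tuple R #|G|.+1).-negligible (@flat R d G @` NG R G),
      hausdorff #|G| (@flat R d G @` NG_inf R G) = 0%E &
      muG (NG_inf R G) = 0%E].
Proof.
pose F := @faithful_poly R d G; have pF : polyfun F := @polyfun_faithful R d G.
have scaled (dl : #|G|.-tuple R) i :
    exists p : {poly R}, forall t, tnth (scale_tuple t dl) i = p.[t].
  by exists (tnth dl i *: 'X) => t; rewrite hornerZ hornerX tnth_mktuple mulrC.
(* By sphere_coord a point of the sphere lies on a face delta_k = 1 or
   delta_k = -1; there eps < 1, which keeps (eps, delta) in the unit cube. *)
have Nnull : finitely_null #|G| (@flat R d G @` NG_inf R G).
  apply: (finitely_null_face_union (B := fun k b =>
     [set z | exists2 j, k = lift ord0 j &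
       [/\ tnth z k = (-1) ^+ (b : bool), supball 1 z & cone_poly z = 0]])).
    move=> k b; case: (unliftP ord0 k) => [j|] kE; last first.
      apply: (finitely_nullS _ (finitely_null0 _ _)) => z [j].
      by rewrite kE => /eqP; rewrite (negPf (neq_lift _ _)).
    apply: (finitely_nullS _ (face_zeros_null (k := k) (s := (-1) ^+ b) (@polyfun_cone R d G) _)).
      by move=> z [].
    exists (tuple_cons (face_scale R d b, [tuple (-1) ^+ b | _ < #|G|])).
      by rewrite kE tnthS tnth_mktuple.
    rewrite cone_polyE (_ : scale_tuple _ _ = [tuple small_weight R d | _ < #|G|]).
      exact: faithful_poly_neq0.
    by apply: eq_from_tnth => i; rewrite !tnth_mktuple face_scaleK.
  move=> _ [[dl e] [Ndl [/= sdl _]] <-]; have [M _] := Ndl.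
  have [cdl _ _] := M; have [k [b kb]] := sphere_coord cdl sdl.
  exists (lift ord0 k), b, k => //; split.
  - by rewrite tnthS.
  - move=> i; case: (unliftP ord0 i) => [j|] ->; first by rewrite tnthS cube_star_norm.
    rewrite tnth0 /=; have /(MG_eps_lt1 hG M)/andP[e0 e1] : `|tnth dl k| = 1.
      by rewrite kb normrX normrN1 expr1n.
    by rewrite ger0_norm ltW.
  - by rewrite /flat cone_polyE; exact: NG_zero.
split; last first.
  split; last first.
  - rewrite /muG (_ : hausdorff _ _ = 0%E) ?mul0e//; apply: finitely_null_hausdorff.
    by apply: finitely_nullS Nnull; apply: image_subset => x [].
  - exact: finitely_null_hausdorff.
  exists [set z | @cone_poly R d G z = 0]; split.
  - by apply: measurable_zeros; exact: polyfun_cone.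
  - apply: (polyfun_zeros_null (x0 := tuple_cons (1, [tuple small_weight R d | _ < #|G|]))).
      exact: polyfun_cone.
    rewrite cone_polyE (_ : scale_tuple _ _ = [tuple small_weight R d | _ < #|G|]).
      exact: faithful_poly_neq0.
    by apply: eq_from_tnth => i; rewrite !tnth_mktuple mul1r.
  - by move=> _ [[dl e] Ndl <-] /=; rewrite /flat cone_polyE; exact: NG_zero.
(* Outside D the whole line through dl consists of zeros. *)
pose D := [set dl | cube_star R G dl /\ exists e, F (scale_tuple e dl) != 0].
have nD dl e : (cube_star R G `\` D) dl -> F (scale_tuple e dl) = 0.
  move=> [cdl nDdl]; apply/eqP; apply: contrapT => /negP Fe; apply: nDdl.
  by split => //; exists e.
exists D; split.
- by move=> dl [].
- exists [set dl | F dl = 0]; split.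
  + exact: measurable_zeros.
  + by apply: (polyfun_zeros_null pF); apply: faithful_poly_neq0.
  + move=> dl /(nD dl 1) <-; congr F.
    by apply: eq_from_tnth => i; rewrite tnth_mktuple mul1r.
- apply: finitely_null_hausdorff.
  apply: (finitely_null_face_union (B := fun k b =>
    [set z | [/\ tnth z k = (-1) ^+ (b : bool), supball 1 z &
      F (scale_tuple (face_scale R d b) z) = 0]])).
    move=> k b; apply: (face_zeros_null (f := fun z => F (scale_tuple (face_scale R d b) z))).
      apply: (polyfun_comp pF) => i; under eq_fun do rewrite tnth_mktuple.
      by apply: polyfunM; [exact: polyfun_cst|exact: polyfun_coord].
    exists [tuple (-1) ^+ b | _ < #|G|]; first by rewrite tnth_mktuple.
    rewrite (_ : scale_tuple _ _ = [tuple small_weight R d | _ < #|G|]).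
      exact: faithful_poly_neq0.
    by apply: eq_from_tnth => i; rewrite !tnth_mktuple face_scaleK.
  move=> dl [sdl nDdl]; have [cdl _] := nDdl.
  have [k [b kb]] := sphere_coord cdl sdl.
  exists k, b; split => //; first by move=> i; exact: cube_star_norm.
  exact: nD.
- move=> dl [cdl [e Fe]].
  apply: (@sub_finite_set _ _ [set t | F (scale_tuple t dl) = 0]).
    by move=> t; exact: NG_zero.
  by apply: (polyfun_line_finite (u := fun t => scale_tuple t dl) pF); [exact: scaled|exists e].
Qed.
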